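(* Let $\Omega,G,\Lambda,\mu,q,\eta,H,\varepsilon,\nu$ satisfy the standing assumptions listed in the context, and let $0<S<\infty$. Let $U$ be a positive-time classical solution on $[0,S]$ of $$U_t=\mathcal K[U]-\mu\,\mathcal R_\eta(x,U)\ \text{ in }(0,S]\times\Omega,$$ with $U(t,x)=0$ for $t>0$ and $x\in\partial\Omega$, with initial datum $U^0\in C^{2+\alpha}(\overline\Omega)$ satisfying $U^0=0$ on $\partial\Omega$, with $U(t)\to U^0$ in $C^1(\overline\Omega)$ as $t\downarrow0$, and with $0\le U\le1$. Then there exists a constant $$C_\nabla=C_\nabla\bigl(S,\Omega,d,\varepsilon,\nu,g_*,g^*,\|G\|_{C^{3+\alpha}(\overline\Omega)},\|\Lambda\|_{C^{1+\alpha}(\overline\Omega)},\mu,q,\eta,H,\|U^0\|_{C^{2+\alpha}(\overline\Omega)}\bigr),$$ depending only on the listed quantities, such that $$\|\nabla U\|_{L^\infty((0,S)\times\Omega)}\le C_\nabla.$$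
   Context: Standing assumptions. $\alpha\in(0,1)$, $d\in\{2,3,4\}$, and $\Omega\subset\mathbb R^d$ is a bounded connected open set with $C^{4+\alpha}$ boundary. $\varepsilon>0$, $\nu>0$ and $\mu\ge0$ are fixed. $G\in C^{3+\alpha}(\overline\Omega)$ with $0<g_*\le G(x)\le g^*$ on $\overline\Omega$ for constants $g_*,g^*$. $\Lambda\in C^{1+\alpha}(\overline\Omega)$, $\Lambda\ge0$. $q\in(0,1)$ and $0<\eta<\min\{q,1-q\}$. $H\in C^\infty(\mathbb R)$ satisfies $0\le H\le1$, $H'\ge0$, $H(s)=0$ for $s\le-1$, $H(s)=1$ for $s\ge1$. Notation. $H_\eta(s)=H(s/\eta)$, $\mathcal R_\eta(x,r)=\Lambda(x)H_\eta(r-q)$, $A_\varepsilon(p)=\sqrt{\varepsilon^2+|p|^2}$, and $$\mathcal K[v]=\nu\Delta v+A_\varepsilon(\nabla v)\,\mathrm{div}\!\left(G(x)\frac{\nabla v}{A_\varepsilon(\nabla v)}\right).$$ Solutions. A positive-time classical solution on $[0,S]$ is $u\in C([0,S];C^1(\overline\Omega))\cap C^{1,2}((0,S]\times\overline\Omega)$ ($C^1$ in $t$, $C^2$ in $x$) that satisfies the PDE pointwise for $t>0$, attains the initial data, and satisfies $u(t,x)=0$ for $t>0$, $x\in\partial\Omega$. *)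

(* Defs.v *)
(* R^d is 'rV[R]_d; its library norm is the
   max-norm (used only for topology and for [ball]); [enorm] is Euclidean. *)
From HB Require Import structures.
From mathcomp Require Import all_boot all_order all_algebra.
From mathcomp Require Import all_classical all_reals all_analysis.
Import Order.TTheory GRing.Theory Num.Theory.
Import numFieldNormedType.Exports.

Set Implicit Arguments.
Unset Strict Implicit.
Unset Printing Implicit Defensive.

Local Open Scope classical_set_scope.
Local Open Scope ring_scope.

Definition enorm (R : realType) (d : nat) (p : 'rV[R]_d) : R :=
  Num.sqrt (\sum_(i < d) p 0 i ^+ 2).

Definition partial (R : realType) (d : nat) (i : 'I_d) (f : 'rV[R]_d -> R) :
  'rV[R]_d -> R := fun x => 'D_(delta_mx 0 i) f x.

(* The sequence [:: i1; ..; im] encodes the derivative d_i1 (d_i2 (.. (d_im f))). *)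
Definition iter_partial (R : realType) (d : nat) (s : seq 'I_d)
  (f : 'rV[R]_d -> R) : 'rV[R]_d -> R := foldr (@partial R d) f s.

Definition grad (R : realType) (d : nat) (f : 'rV[R]_d -> R) (x : 'rV[R]_d) :
  'rV[R]_d := \row_(i < d) partial i f x.

Definition divergence (R : realType) (d : nat) (F : 'rV[R]_d -> 'rV[R]_d)
  (x : 'rV[R]_d) : R := \sum_(i < d) partial i (fun y => F y 0 i) x.

Definition laplacian (R : realType) (d : nat) (f : 'rV[R]_d -> R)
  (x : 'rV[R]_d) : R := divergence (grad f) x.

Definition boundary (T : topologicalType) (Omega : set T) : set T :=
  closure Omega `\` interior Omega.

Definition partials_exist (R : realType) (d k : nat) (Omega : set 'rV[R]_d)
  (f : 'rV[R]_d -> R) : Prop :=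
  forall (s : seq 'I_d) (i : 'I_d) (x : 'rV[R]_d), (size s < k)%N -> Omega x ->
    derivable (iter_partial s f) x (delta_mx 0 i).

(* f is in C^k(closure Omega), Omega open: all derivatives of order <= k exist
   in Omega and extend continuously to closure Omega. *)
Definition Ck_closure (R : realType) (d k : nat) (Omega : set 'rV[R]_d)
  (f : 'rV[R]_d -> R) : Prop :=
  [/\ {within closure Omega, continuous f},
      partials_exist k Omega f
    & forall s : seq 'I_d, (size s <= k)%N ->
        exists g : 'rV[R]_d -> R, {within closure Omega, continuous g} /\
          forall x, Omega x -> iter_partial s f x = g x].

Definition sup_order (R : realType) (d j : nat) (Omega : set 'rV[R]_d)
  (f : 'rV[R]_d -> R) : \bar R :=
  ereal_sup [set M | exists (s : seq 'I_d) (x : 'rV[R]_d),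
    [/\ size s = j, Omega x & M = (`|iter_partial s f x|)%:E]].

Definition Ck_norm (R : realType) (d k : nat) (Omega : set 'rV[R]_d)
  (f : 'rV[R]_d -> R) : \bar R :=
  (\sum_(0 <= j < k.+1) sup_order j Omega f)%E.

Definition holder_seminorm (R : realType) (d k : nat) (alpha : R)
  (Omega : set 'rV[R]_d) (f : 'rV[R]_d -> R) : \bar R :=
  ereal_sup [set M | exists (s : seq 'I_d) (x y : 'rV[R]_d),
    [/\ size s = k, Omega x, Omega y, x != y
      & M = (`|iter_partial s f x - iter_partial s f y|
               / (enorm (x - y) `^ alpha))%:E]].

Definition holder_norm (R : realType) (d k : nat) (alpha : R)
  (Omega : set 'rV[R]_d) (f : 'rV[R]_d -> R) : \bar R :=
  (Ck_norm k Omega f + holder_seminorm k alpha Omega f)%E.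

(* f is in C^(k+alpha)(closure Omega) *)
Definition holder_class (R : realType) (d k : nat) (alpha : R)
  (Omega : set 'rV[R]_d) (f : 'rV[R]_d -> R) : Prop :=
  Ck_closure k Omega f /\ (holder_norm k alpha Omega f < +oo)%E.

(* Near each boundary point, after relabelling and reorienting the coordinate
   axes, Omega is the region above the graph of a C^(k+alpha) function of the
   other d - 1 coordinates ([col' i x] is x with its i-th entry deleted; as
   balls are max-norm cubes, it maps [ball x0 r] onto [ball (col' i x0) r]). *)
Definition holder_boundary (R : realType) (d k : nat) (alpha : R)
  (Omega : set 'rV[R]_d) : Prop :=
  forall x0 : 'rV[R]_d, boundary Omega x0 ->
    exists (r : R) (i : 'I_d) (b : bool) (gamma : 'rV[R]_(d.-1) -> R),
      [/\ 0 < r,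
          holder_class k alpha (ball (col' i x0) r) gamma
        & forall x : 'rV[R]_d, ball x0 r x ->
            (Omega x <-> gamma (col' i x) < (-1) ^+ b * x 0 i)].

Definition A_eps (R : realType) (d : nat) (eps : R) (p : 'rV[R]_d) : R :=
  Num.sqrt (eps ^+ 2 + enorm p ^+ 2).

Definition K_op (R : realType) (d : nat) (eps nu : R) (G v : 'rV[R]_d -> R)
  (x : 'rV[R]_d) : R :=
  nu * laplacian v x +
  A_eps eps (grad v x) *
    divergence (fun y => (G y / A_eps eps (grad v y)) *: grad v y) x.

Definition R_eta (R : realType) (d : nat) (q eta : R) (H : R -> R)
  (Lam : 'rV[R]_d -> R) (x : 'rV[R]_d) (r : R) : R :=
  Lam x * H ((r - q) / eta).

Definition smooth_cutoff (R : realType) (H : R -> R) : Prop :=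
  [/\ forall (n : nat) (s : R), derivable (derive1n n H) s 1,
      forall s, 0 <= H s <= 1,
      forall s, 0 <= derive1 H s,
      forall s, s <= -1 -> H s = 0
    & forall s, 1 <= s -> H s = 1].

(* The limits defining u_t(t,x) run over times in ]0, S] only, so the
   derivative is one-sided at t = S. *)
Definition time_quotient (R : realType) (d : nat) (u : R -> 'rV[R]_d -> R)
  (t : R) (x : 'rV[R]_d) : R -> R := fun s => (u s x - u t x) / (s - t).

Definition time_derivable (R : realType) (d : nat) (S : R)
  (u : R -> 'rV[R]_d -> R) (t : R) (x : 'rV[R]_d) : Prop :=
  cvg (time_quotient u t x @ within `]0, S] (t^')).

Definition time_derivative (R : realType) (d : nat) (S : R)
  (u : R -> 'rV[R]_d -> R) (t : R) (x : 'rV[R]_d) : R :=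
  lim (time_quotient u t x @ within `]0, S] (t^')).

(* u is in C([0,S]; C^1(closure Omega)) *)
Definition C_C1 (R : realType) (d : nat) (S : R) (Omega : set 'rV[R]_d)
  (u : R -> 'rV[R]_d -> R) : Prop :=
  forall t, 0 <= t <= S ->
    Ck_closure 1 Omega (u t) /\
    Ck_norm 1 Omega (u s \- u t) @[s --> within `[0, S] (nbhs t)] --> 0%E.

(* u is in C^{1,2}(]0,S] x closure Omega) *)
Definition C12 (R : realType) (d : nat) (S : R) (Omega : set 'rV[R]_d)
  (u : R -> 'rV[R]_d -> R) : Prop :=
  let Q : set (R * 'rV[R]_d) := `]0, S] `*` closure Omega in
  [/\ {within Q, continuous (fun z => u z.1 z.2)},
      forall t x, 0 < t <= S -> closure Omega x -> time_derivable S u t x,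
      {within Q, continuous (fun z => time_derivative S u z.1 z.2)},
      forall t, 0 < t <= S -> partials_exist 2 Omega (u t)
    & forall s : seq 'I_d, (size s <= 2)%N ->
        exists g : R * 'rV[R]_d -> R, {within Q, continuous g} /\
          forall t x, 0 < t <= S -> Omega x ->
            iter_partial s (u t) x = g (t, x)].

Definition classical_solution (R : realType) (d : nat) (S : R)
  (Omega : set 'rV[R]_d) (eps nu mu q eta : R) (H : R -> R)
  (G Lam U0 : 'rV[R]_d -> R) (U : R -> 'rV[R]_d -> R) : Prop :=
  [/\ C_C1 S Omega U,
      C12 S Omega U,
      forall t x, 0 < t <= S -> Omega x ->
        time_derivative S U t x =
          K_op eps nu G (U t) x - mu * R_eta q eta H Lam x (U t x),
      forall x, closure Omega x -> U 0 x = U0 x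
    & forall t x, 0 < t <= S -> boundary Omega x -> U t x = 0].

(* Lebesgue-null sets of R x R^d, via countable covers by closed boxes
   [a k, b k] x prod_i [l k i, h k i] of arbitrarily small total volume. *)
Definition lebesgue_null (R : realType) (d : nat) (E : set (R * 'rV[R]_d)) :
  Prop :=
  forall e : R, 0 < e ->
    exists (a b : nat -> R) (l h : nat -> 'rV[R]_d),
      [/\ forall k, a k <= b k /\ forall i, l k 0 i <= h k 0 i,
          E `<=` \bigcup_k [set z : R * 'rV[R]_d | a k <= z.1 <= b k /\
                              forall i, l k 0 i <= z.2 0 i <= h k 0 i]
        & (\sum_(0 <= k <oo)
             ((b k - a k) * \prod_(i < d) (h k 0 i - l k 0 i))%:E <= e%:E)%E].

Definition Linfty_norm (R : realType) (d : nat) (D : set (R * 'rV[R]_d))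
  (F : R * 'rV[R]_d -> 'rV[R]_d) : \bar R :=
  ereal_inf [set M : \bar R | (0 <= M)%E /\
    lebesgue_null [set z | D z /\ (M < (enorm (F z))%:E)%E]].

(* Main.v *)
Require Import Defs.
From HB Require Import structures.
From mathcomp Require Import all_boot all_order all_algebra.
From mathcomp Require Import all_classical all_reals all_analysis.
From mathcomp Require Import ring lra.
Import Order.TTheory GRing.Theory Num.Theory.
Import numFieldNormedType.Exports.

Set Implicit Arguments.
Unset Strict Implicit.
Unset Printing Implicit Defensive.

Local Open Scope classical_set_scope.
Local Open Scope ring_scope.

(** The solution [U] is only C^2 in space, so the equation cannot be
    differentiated, and Bernstein's method is not available. The gradient is
    bounded instead by doubling the space variable. On the set where
    [|x - y| <= 1/lam], the claim is
      [U t x - U t y <= psi |x - y|]  with  [psi r = K (r - lam r^2 / 2)],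
    and letting [y] tend to [x] gives [|grad U| <= K].

    Suppose that the difference of the two sides has a positive maximum. It is
    not attained where [|x - y| = 1/lam], since [U <= 1 <= psi (1/lam)], nor at
    time 0, since [K/2] is at least the Lipschitz constant of the initial datum. At
    an interior maximum both gradients equal [P e], with [e] the unit vector
    along [x - y] and [P = psi' |x - y|], so the two diffusion matrices are
    diagonal in the same frame, with eigenvalue [nu + G] on the orthogonal of
    [e] and [nu + G eps^2 / (eps^2 + P^2) >= nu] along [e] ([K_op_polar]).
    Second-order tests with opposite displacements of [x] and [y] along [e] gain
    [-4 nu K lam]. Parallel displacements orthogonal to [e] cost
    [(sqrt (nu + G x) - sqrt (nu + G y))^2 P / |x - y|], which is bounded because
    [G] is Lipschitz on the segment from [x] to [y]. The transport and reaction
    terms are bounded too, so a large [lam] contradicts the equation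
    ([two_point_no_interior_max]).

    If the segment from [x] to [y] leaves the domain, then it meets the boundary
    at some [w]; as [U] vanishes at [w] and [0 <= U], the claim follows from
    [U t x <= psi |x - w|]. This boundary estimate is the
    comparison of [U] with the barrier [psi (|x - z| - rho)], where the ball of
    center [z] and radius [rho] touches the closed domain from outside at [w]
    ([barrier_estimate]). A common [rho] exists for all boundary points since the
    boundary is compact and is locally the graph of a function with bounded
    second derivatives ([exterior_ball_uniform]). *)

(** * Euclidean geometry of row vectors *)

Section Euclid.
Context {R : realType} {d : nat}.
Implicit Types x y z v w : 'rV[R]_d.

Definition dot x y : R := \sum_i x 0 i * y 0 i.

Lemma dotC x y : dot x y = dot y x.
Proof. by apply: eq_bigr => i _; rewrite mulrC. Qed.

Lemma dotDl x y z : dot (x + y) z = dot x z + dot y z.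
Proof. by rewrite -big_split; apply: eq_bigr => i _; rewrite mxE mulrDl. Qed.

Lemma dotZl (a : R) x y : dot (a *: x) y = a * dot x y.
Proof. by rewrite mulr_sumr; apply: eq_bigr => i _; rewrite mxE mulrA. Qed.

Lemma dotDr x y z : dot x (y + z) = dot x y + dot x z.
Proof. by rewrite dotC dotDl ![dot _ x]dotC. Qed.

Lemma dotZr (a : R) x y : dot x (a *: y) = a * dot x y.
Proof. by rewrite dotC dotZl dotC. Qed.

Lemma dotNl x y : dot (- x) y = - dot x y.
Proof. by rewrite -scaleN1r dotZl mulN1r. Qed.

Lemma dotNr x y : dot x (- y) = - dot x y.
Proof. by rewrite dotC dotNl dotC. Qed.

Lemma dot_delta x i : dot (delta_mx 0 i) x = x 0 i.
Proof.
rewrite /dot (bigD1 i) //= mxE !eqxx mul1r big1 ?addr0// => j /negPf ji.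
by rewrite mxE ji mul0r.
Qed.

Lemma dotxx_ge0 x : 0 <= dot x x.
Proof. by apply: sumr_ge0 => i _; rewrite -expr2 sqr_ge0. Qed.

Lemma enormE x : enorm x = Num.sqrt (dot x x).
Proof. by congr Num.sqrt; apply: eq_bigr => i _; rewrite expr2. Qed.

Lemma enorm_sq x : enorm x ^+ 2 = dot x x.
Proof. by rewrite enormE sqr_sqrtr ?dotxx_ge0. Qed.

Lemma enorm_ge0 x : 0 <= enorm x.
Proof. exact: sqrtr_ge0. Qed.

Lemma enormZ (a : R) x : enorm (a *: x) = `|a| * enorm x.
Proof.
by rewrite !enormE dotZl dotZr mulrA -expr2 sqrtrM ?sqr_ge0// sqrtr_sqr.
Qed.

Lemma enormN x : enorm (- x) = enorm x.
Proof. by rewrite !enormE dotNl dotNr opprK. Qed.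

Lemma enormBC x y : enorm (x - y) = enorm (y - x).
Proof. by rewrite -enormN opprB. Qed.

Lemma enorm_le x (a : R) : 0 <= a -> dot x x <= a ^+ 2 -> enorm x <= a.
Proof.
by move=> a0 xa; rewrite -(ler_pXn2r (n := 2)) ?nnegrE ?enorm_ge0// enorm_sq.
Qed.

Lemma enorm0_eq x : enorm x = 0 -> x = 0.
Proof.
move=> x0; have /eqP := enorm_sq x; rewrite x0 expr0n eq_sym /= psumr_eq0 => [|i _].
  move=> /allP h; apply/rowP => i; rewrite mxE; apply/eqP.
  by have := h i (mem_index_enum _); rewrite /= mulf_eq0 orbb.
by rewrite -expr2 sqr_ge0.
Qed.

Lemma dot_le_enorm x y : dot x y <= enorm x * enorm y.
Proof.
have [x0|x0] := eqVneq (enorm x) 0.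
  rewrite x0 mul0r (enorm0_eq x0) /dot big1// => i _; by rewrite mxE mul0r.
have [y0|y0] := eqVneq (enorm y) 0.
  rewrite y0 mulr0 (enorm0_eq y0) /dot big1// => i _; by rewrite mxE mulr0.
have := dotxx_ge0 (enorm y *: x - enorm x *: y).
rewrite !(dotDl, dotDr, dotNl, dotNr, dotZl, dotZr) (dotC y x) -!enorm_sq.
have xp : 0 < enorm x by rewrite lt_neqAle eq_sym x0 enorm_ge0.
have yp : 0 < enorm y by rewrite lt_neqAle eq_sym y0 enorm_ge0.
move=> h; rewrite -subr_ge0 -(pmulr_rge0 _ (mulr_gt0 xp yp)).
move: h; set a := enorm x; set b := enorm y; set c := dot x y => h.
lra.
Qed.

Lemma enorm_triangle x y : enorm (x + y) <= enorm x + enorm y.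
Proof.
apply: enorm_le; first by rewrite addr_ge0 ?enorm_ge0.
rewrite !(dotDl, dotDr) (dotC y x) sqrrD !enorm_sq.
have := dot_le_enorm x y; lra.
Qed.

Lemma coord_le_enorm x i : `|x 0 i| <= enorm x.
Proof.
rewrite -(ler_pXn2r (n := 2)) ?nnegrE ?enorm_ge0// enorm_sq real_normK ?num_real//.
rewrite /dot (bigD1 i) //= -expr2 lerDl; apply: sumr_ge0 => j _.
by rewrite -expr2 sqr_ge0.
Qed.

Lemma norm_le_enorm x : `|x| <= enorm x.
Proof.
rewrite /Num.norm /= mx_normrE; apply/bigmax_leP => /=; split; first exact: enorm_ge0.
by move=> [i j] _ /=; rewrite (ord1 i) coord_le_enorm.
Qed.

Lemma coord_le_norm x i : `|x 0 i| <= `|x|.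
Proof.
rewrite [leRHS]/Num.norm /= mx_normrE; apply/bigmax_geP; right => /=.
by exists (0, i).
Qed.

Lemma dot_bound v w (M : R) :
  (forall i, `|w 0 i| <= M) -> `|dot v w| <= d%:R * M * enorm v.
Proof.
move=> wM; rewrite /dot (le_trans (ler_norm_sum _ _ _))//.
apply: (@le_trans _ _ (\sum_(i < d) M * enorm v)).
  apply: ler_sum => i _; rewrite normrM mulrC.
  by apply: ler_pM => //; exact: coord_le_enorm.
by rewrite sumr_const card_ord -mulr_natl; lra.
Qed.

Lemma dot_continuous (T : topologicalType) (f g : T -> 'rV[R]_d) (F : set_system T)
    (FF : Filter F) a b :
  f @ F --> a -> g @ F --> b -> dot (f t) (g t) @[t --> F] --> dot a b.
Proof.
move=> fa gb; apply: cvg_big; first exact: add_continuous; move=> i _; apply: cvgM.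
  by apply: (@cvg_comp _ _ _ f (fun M : 'rV[R]_d => M 0 i) _ _ _ fa); exact: coord_continuous.
by apply: (@cvg_comp _ _ _ g (fun M : 'rV[R]_d => M 0 i) _ _ _ gb); exact: coord_continuous.
Qed.

Lemma enorm_continuous : continuous (@enorm R d).
Proof.
move=> x; rewrite /continuous_at enormE.
have -> : @enorm R d = (@Num.sqrt R) \o (fun y => dot y y).
  by apply/funext => y; exact: enormE.
apply: (@continuous_comp _ _ _ (fun y => dot y y) (@Num.sqrt R)).
  by apply: (@dot_continuous _ id id (nbhs x) _ x x); exact: cvg_id.
exact: sqrt_continuous.
Qed.

End Euclid.

(** * Differentiation along segments *)

Lemma within_comp (T U V : topologicalType) (A : set T) (B : set U)
    (g : T -> U) (f : U -> V) :
  {within A, continuous g} -> (forall t, A t -> B (g t)) ->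
  {within B, continuous f} -> {within A, continuous (f \o g)}.
Proof.
move=> /subspace_continuousP cg AB /subspace_continuousP cf.
apply/subspace_continuousP => t At W /(cf _ (AB _ At)) fW.
have := cg _ At _ fW; rewrite /nbhs /= /within /=.
by apply: filterS => s h As; exact: h As (AB s As).
Qed.

Section Calculus.
Context {R : realType} {d : nat}.
Implicit Types (f : 'rV[R]_d -> R) (D : set 'rV[R]_d) (x y v : 'rV[R]_d).

(** On an open set, the existence and continuity of the partial derivatives
    characterise C^1 functions. *)
Definition C1_on D f := forall i x, D x ->
  derivable f x (delta_mx 0 i) /\ {for x, continuous (partial i f)}.

Lemma line_derive f x v (t l : R) :
  is_derive (x + t *: v) v f l -> is_derive t 1 (fun s : R => f (x + s *: v)) l.
Proof.
have e : (fun h : R => h^-1 *: (((fun s : R => f (x + s *: v)) \o shift t) (h *: 1)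
        - f (x + t *: v)))
    = (fun h : R => h^-1 *: ((f \o shift (x + t *: v)) (h *: v) - f (x + t *: v))).
  apply/funext => h /=; rewrite [h%:A]mulr1; congr (_ *: (f _ - _)).
  by rewrite scalerDl addrCA.
move=> [df dl]; split; first by rewrite /derivable e.
by rewrite -dl /derive e.
Qed.

Lemma open_ball_sub D x : open D -> D x -> exists2 r : R, 0 < r & ball x r `<=` D.
Proof. by move=> oD Dx; have /nbhs_ballP := open_nbhs_nbhs (conj oD Dx). Qed.

Lemma norm_delta i : `|delta_mx 0 i : 'rV[R]_d| <= 1.
Proof.
rewrite [leLHS]/Num.norm /= mx_normrE; apply/bigmax_leP => /=; split => // -[a b] _.
by rewrite mxE /=; case: (_ && _); rewrite ?normr1 ?normr0.
Qed.

(** Uniformity in the base point [y] is what allows the coordinates to be moved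
    one after the other in [C1_is_derive]. *)
Lemma partial_increment D f x i (e : R) :
  open D -> C1_on D f -> D x -> 0 < e ->
  exists2 r : R, 0 < r & forall y (s : R), `|y - x| < r -> `|s| < r ->
    `|f (y + s *: delta_mx 0 i) - f y - s * partial i f x| <= e * `|s|.
Proof.
move=> oD fD Dx e0.
have [r0 r00 rD] := open_ball_sub oD Dx.
have [_ /cvgrPdist_le /(_ _ e0) /nbhs_ballP[r1 /= r10 r1P]] := fD i x Dx.
set r := Num.min r0 r1 / 2.
have r_gt0 : 0 < r by rewrite divr_gt0 ?lt_min ?r00 ?r10.
exists r => // y s yr sr.
have near_x (t : R) : `|t| <= `|s| ->
    D (y + t *: delta_mx 0 i) /\ `|partial i f (y + t *: delta_mx 0 i) - partial i f x| <= e.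
  move=> ts.
  have lt : `|x - (y + t *: delta_mx 0 i)| < Num.min r0 r1.
    rewrite opprD addrA (le_lt_trans (ler_normB _ _))// normrZ.
    have : `|t| * `|delta_mx 0 i : 'rV[R]_d| <= `|s|.
      by rewrite -[leRHS]mulr1 ler_pM ?norm_delta.
    have : `|x - y| < r by rewrite distrC.
    have : Num.min r0 r1 = r + r by rewrite /r; lra.
    lra.
  move: lt; rewrite lt_min => /andP[l0 l1]; split.
    by apply: rD; rewrite -ball_normE.
  rewrite distrC; apply: r1P; by rewrite -ball_normE.
have dline (t : R) : `|t| <= `|s| -> is_derive t 1
    (fun u : R => f (y + u *: delta_mx 0 i)) (partial i f (y + t *: delta_mx 0 i)).
  move=> ts; apply: line_derive; apply: derivableP.
  by have [Dy _] := near_x t ts; have [] := fD i _ Dy.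
have key (a b : R) : a <= b -> (forall c, c \in `[a, b]%R -> `|c| <= `|s|) ->
   `|f (y + b *: delta_mx 0 i) - f (y + a *: delta_mx 0 i) - (b - a) * partial i f x|
     <= e * (b - a).
  move=> ab cs.
  have [c cab ->] : exists2 c, c \in `[a, b]%R &
    f (y + b *: delta_mx 0 i) - f (y + a *: delta_mx 0 i) =
    partial i f (y + c *: delta_mx 0 i) * (b - a).
    apply: (@MVT_segment _ (fun u : R => f (y + u *: delta_mx 0 i))
       (fun c => partial i f (y + c *: delta_mx 0 i))) => //.
      by move=> c cab; apply: dline; apply: cs; exact: subset_itv_oo_cc.
    apply: derivable_within_continuous => c /cs cab.
    by have [] := dline c cab.
  rewrite (mulrC (b - a)) -mulrBl normrM (ger0_norm (x := b - a)) ?subr_ge0//.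
  by rewrite ler_wpM2r ?subr_ge0//; have [] := near_x c (cs c cab).
have [s0|s0] := leP 0 s.
  have := key 0 s s0; rewrite scale0r addr0 subr0 (ger0_norm s0); apply.
  by move=> c; rewrite in_itv /= => /andP[c0 cs]; rewrite !ger0_norm.
have := key s 0 (ltW s0); rewrite scale0r addr0 sub0r (ltr0_norm s0).
move=> h; rewrite -normrN.
have -> : - (f (y + s *: delta_mx 0 i) - f y - s * partial i f x) =
 f y - f (y + s *: delta_mx 0 i) - - s * partial i f x by ring.
apply: h => c; rewrite in_itv /= => /andP[cs c0].
by rewrite ler0_norm// lerN2.
Qed.

(** A displacement [h v] is split into [d] displacements along the axes; each of
    them contributes [h v_k d_k f x + o(h)] by the mean value theorem and the
    continuity of the partial derivatives at [x]. *)
Lemma C1_is_derive D f x v : open D -> C1_on D f -> D x ->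
  is_derive x v f (dot v (grad f x)).
Proof.
move=> oD fD Dx.
pose vk k : 'rV[R]_d := \row_i (if (i < k)%N then v 0 i else 0).
pose lk k := \sum_(i < d | (i < k)%N) v 0 i * partial i f x.
have step k : (k <= d)%N -> forall e : R, 0 < e ->
    \forall h \near 0, `|f (h *: vk k + x) - f x - h * lk k| <= e * `|h|.
  elim: k => [_ e e0|k IH kd e e0].
    near=> h; rewrite /lk big_pred0_eq mulr0 subr0.
    have -> : vk 0%N = 0 by apply/rowP => i; rewrite !mxE.
    by rewrite scaler0 add0r subrr normr0 mulr_ge0// ltW.
  pose ik := Ordinal kd.
  have vkS : vk k.+1 = vk k + v 0 ik *: delta_mx 0 ik.
    apply/rowP => i; rewrite !mxE ltnS leq_eqVlt /=.
    have [ik_|ik_] := eqVneq (i : nat) k.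
      have -> : i = ik by apply/val_inj.
      by rewrite ltnn eqxx /= mulr1 add0r.
    have /negPf -> : i != ik by apply: contraNneq ik_ => ->.
    by rewrite mulr0 addr0.
  have lkS : lk k.+1 = lk k + v 0 ik * partial ik f x.
    rewrite /lk (bigD1 ik) /= ?ltnSn// addrC; congr (_ + _).
    apply: eq_bigl => i; rewrite ltnS leq_eqVlt.
    have [->|ik_] := eqVneq i ik; first by rewrite ltnn andbF.
    rewrite andbT; have /negPf -> // : (i : nat) != k.
    by apply: contraNneq ik_ => h; apply/eqP/val_inj.
  have e2 : 0 < e / 2 by rewrite divr_gt0.
  pose c := e / 2 / (`|v 0 ik| + 1).
  have v1 : 0 < `|v 0 ik| + 1 by rewrite ltr_wpDl.
  have c0 : 0 < c by rewrite divr_gt0.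
  have [r r0 rP] := partial_increment ik oD fD Dx c0.
  have hk : \forall h \near (0 : R), `|h *: vk k| < r.
    have : h *: vk k @[h --> (0 : R)] --> (0 : R) *: vk k.
      by apply: cvgZr_tmp; exact: cvg_id.
    rewrite scale0r => /cvgr0Pnorm_lt; exact.
  have hv : \forall h \near (0 : R), `|h * v 0 ik| < r.
    have : h * v 0 ik @[h --> (0 : R)] --> (0 : R) * v 0 ik.
      by apply: cvgMr_tmp; exact: cvg_id.
    rewrite mul0r => /cvgr0Pnorm_lt; exact.
  near=> h.
  have h1 : `|f (h *: vk k + x) - f x - h * lk k| <= e / 2 * `|h|.
    by near: h; apply: IH => //; exact: ltnW.
  have h2 : `|f (h *: vk k + x + (h * v 0 ik) *: delta_mx 0 ik) - f (h *: vk k + x)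
     - (h * v 0 ik) * partial ik f x| <= c * `|h * v 0 ik|.
    apply: rP; first by rewrite addrK; near: h.
    by near: h.
  have h3 : c * `|h * v 0 ik| <= e / 2 * `|h|.
    rewrite /c normrM (mulrC `|h|) mulrA ler_wpM2r// -mulrA.
    rewrite ler_piMr ?(ltW e2)// mulrC ler_pdivrMr// mul1r; lra.
  have -> : f (h *: vk k.+1 + x) - f x - h * lk k.+1 =
     (f (h *: vk k + x) - f x - h * lk k) +
     (f (h *: vk k + x + (h * v 0 ik) *: delta_mx 0 ik) - f (h *: vk k + x)
     - (h * v 0 ik) * partial ik f x).
    rewrite vkS lkS scalerDr scalerA.
    rewrite (addrAC (h *: vk k)).
    ring.
  apply: (le_trans (ler_normD _ _)); lra.
have vd : vk d = v by apply/rowP => i; rewrite !mxE ltn_ord.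
have ld : lk d = dot v (grad f x).
  by apply: eq_big => [i|i _]; rewrite ?ltn_ord// !mxE.
have cv : (fun h => h^-1 *: ((f \o shift x) (h *: v) - f x)) @ 0^' --> dot v (grad f x).
  apply/cvgrPdist_le => e e0.
  have := step d (leqnn d) _ e0; rewrite vd ld => /nbhs_ballP[r /= r0 rP].
  exists r => //= h /= hr hn0.
  have hi : 0 < `|h^-1| by rewrite normr_gt0 invr_eq0.
  have := rP h hr; rewrite -(ler_pM2l hi).
  rewrite -normrM mulrCA -normrM mulVf// normr1 mulr1 distrC.
  by rewrite mulrBr mulrA mulVf// mul1r.
split; first by apply/cvg_ex; eexists; exact: cv.
by apply: cvg_lim => //.
Unshelve. all: by end_near. Qed.


Lemma ball_segment D x v : open D -> D x ->
  exists2 r : R, 0 < r & forall t : R, `|t| < r -> D (x + t *: v).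
Proof.
move=> oD Dx; have [r r0 rD] := open_ball_sub oD Dx.
have v1 : 0 < `|v| + 1 by rewrite ltr_wpDl.
exists (r / (`|v| + 1)); first by rewrite divr_gt0.
move=> t tr; apply: rD; rewrite -ball_normE /= opprD addrA subrr sub0r normrN normrZ.
rewrite (@le_lt_trans _ _ (`|t| * (`|v| + 1)))//; last by rewrite -ltr_pdivlMr.
by rewrite ler_wpM2l// lerDl.
Qed.

Lemma segment_mvt D f x y : open D -> C1_on D f ->
  (forall t : R, 0 < t < 1 -> D (x + t *: (y - x))) ->
  {within `[0, 1], continuous (fun t : R => f (x + t *: (y - x)))} ->
  exists2 c : R, 0 < c < 1 & f y - f x = dot (y - x) (grad f (x + c *: (y - x))).
Proof.
move=> oD fD segD cf.
have dline (c : R) : c \in `]0, 1[%R -> is_derive c 1 (fun t : R => f (x + t *: (y - x)))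
    (dot (y - x) (grad f (x + c *: (y - x)))).
  rewrite in_itv /= => /segD Dc.
  by apply: line_derive; apply: C1_is_derive fD Dc.
have [c] := MVT ltr01 dline cf.
rewrite in_itv /= => c01; rewrite scale1r scale0r addr0 subr0 mulr1 (addrC x (y - x)) subrK => e.
by exists c.
Qed.

Lemma C1_segment_continuous D f x y : open D -> C1_on D f ->
  (forall t : R, 0 <= t <= 1 -> D (x + t *: (y - x))) ->
  {within `[0, 1], continuous (fun t : R => f (x + t *: (y - x)))}.
Proof.
move=> oD fD segD; apply: derivable_within_continuous => t.
rewrite in_itv /= => /segD Dt.
by have [] := line_derive (C1_is_derive (y - x) oD fD Dt).
Qed.

Lemma segment_lipschitz D f x y (M : R) : open D -> C1_on D f ->
  (forall z i, D z -> `|partial i f z| <= M) ->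
  (forall t : R, 0 < t < 1 -> D (x + t *: (y - x))) ->
  {within `[0, 1], continuous (fun t : R => f (x + t *: (y - x)))} ->
  `|f y - f x| <= d%:R * M * enorm (y - x).
Proof.
move=> oD fD fM segD cf.
have [c c01 ->] := segment_mvt oD fD segD cf.
by apply: dot_bound => i; rewrite mxE; apply: fM; exact: segD.
Qed.

Lemma within_closure_segment D f x y : {within closure D, continuous f} ->
  (forall t : R, 0 <= t <= 1 -> closure D (x + t *: (y - x))) ->
  {within `[0, 1], continuous (fun t : R => f (x + t *: (y - x)))}.
Proof.
move=> cf seg; apply: (@within_comp _ _ _ _ (closure D) (fun t : R => x + t *: (y - x)) f) => //.
  apply: continuous_subspaceT => t; apply: cvgD; first exact: cvg_cst.
  by apply: cvgZr_tmp; exact: cvg_id.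
Qed.

Definition C2_on D f := C1_on D f /\ forall j, C1_on D (partial j f).

(** The second derivative as a bilinear form. The operator and the tests at a
    maximum see only its values on pairs of equal vectors. *)
Definition hess f x v w := dot v (\row_j dot w (grad (partial j f) x)).

Lemma hessDl f x v w z : hess f x (v + w) z = hess f x v z + hess f x w z.
Proof. exact: dotDl. Qed.

Lemma hessZl f x (a : R) v z : hess f x (a *: v) z = a * hess f x v z.
Proof. exact: dotZl. Qed.

Lemma hessDr f x v w z : hess f x z (v + w) = hess f x z v + hess f x z w.
Proof.
rewrite /hess -dotDr; congr dot; apply/rowP => j; rewrite !mxE; exact: dotDl.
Qed.

Lemma hessZr f x (a : R) v z : hess f x z (a *: v) = a * hess f x z v.
Proof.
rewrite /hess -dotZr; congr dot; apply/rowP => j; rewrite !mxE; exact: dotZl.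
Qed.

(** If [l > 0] then the derivative [g] is positive on some interval to the right
    of 0, and [phi] increases there. *)
Lemma second_order_max (phi g : R -> R) (r l : R) : 0 < r ->
  (forall t : R, `|t| < r -> is_derive t 1 phi (g t)) -> is_derive (0 : R) 1 g l ->
  (forall t, `|t| < r -> phi t <= phi 0) -> g 0 = 0 /\ l <= 0.
Proof.
move=> r0 dphi [dg gl] phimax.
have nr (t : R) : t \in `](- r), r[%R -> `|t| < r.
  by rewrite in_itv /= => tr; rewrite ltr_norml.
have g0 : g 0 = 0.
  have := @derive1_at_max _ phi (- r) r 0.
  have /[swap] /[apply] : - r <= r by lra.
  have /[swap] /[apply] : {in `](- r), r[%R, forall t, derivable phi t 1}.
    by move=> t /nr /dphi [].
  have /[swap] /[apply] : 0 \in `](- r), r[%R by rewrite in_itv /= oppr_lt0 r0.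
  move=> /(_ (fun t tr => phimax t (nr t tr))) [_ dphi0].
  have n0 : `|0 : R| < r by rewrite normr0.
  by have [_] := dphi 0 n0; rewrite dphi0.
split=> //; rewrite leNgt; apply/negP => l0.
have : (fun h => h^-1 *: ((g \o shift 0) (h *: 1) - g 0)) @ 0^' --> l by rewrite -gl.
move=> /cvgrPdist_lt /(_ _ l0) /nbhs_ballP[e /= e0 eP].
pose t := Num.min e r / 2.
have t0 : 0 < t by rewrite divr_gt0// lt_min e0 r0.
have [te tr] : t < e /\ t < r.
  have : t < Num.min e r by rewrite /t ltr_pdivrMr ?ltr_pMr ?ltr1n// lt_min e0 r0.
  by rewrite lt_min => /andP.
have [c] : exists2 c, c \in `]0, t[%R & phi t - phi 0 = g c * (t - 0).
  apply: MVT => //.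
    move=> c; rewrite in_itv /= => /andP[c0 ct]; apply: dphi.
    by rewrite gtr0_norm// (lt_trans ct).
  apply: derivable_within_continuous => c; rewrite in_itv /= => /andP[c0 ct].
  by have [] := dphi c; rewrite ?ger0_norm// (le_lt_trans ct).
rewrite in_itv /= => /andP[c0 ct] ephi.
have gc : 0 < g c.
  have := eP c; rewrite /= -ball_normE /= sub0r normrN gtr0_norm// (lt_trans ct te).
  move=> /(_ isT); rewrite gt_eqF// => /(_ isT).
  rewrite addr0 [c%:A]mulr1 g0 subr0 => h.
  have : 0 < c^-1 * g c by move: h; rewrite ltr_norml /GRing.scale /=; lra.
  by rewrite pmulr_rgt0// invr_gt0.
have := phimax t; rewrite gtr0_norm// => /(_ tr).
have : 0 < g c * (t - 0) by rewrite subr0 mulr_gt0.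
lra.
Qed.

(** The tests at a maximum of [f x - f y - psi |x - y|]: [x] and [y] move with
    velocities [v] and [w], and the profile is replaced by any quadratic
    polynomial that bounds its increase along this motion. *)
Lemma two_point_test D f x y v w (c1 c2 r : R) : open D -> C2_on D f -> D x -> D y ->
  0 < r ->
  (forall t : R, `|t| < r -> D (x + t *: v) -> D (y + t *: w) ->
    f (x + t *: v) - f (y + t *: w) <= f x - f y + c1 * t + c2 * t ^+ 2) ->
  dot v (grad f x) - dot w (grad f y) = c1 /\
  hess f x v v - hess f y w w <= 2 * c2.
Proof.
move=> oD [fD f2D] Dx Dy r0 le.
have [r1 r10 r1P] := ball_segment v oD Dx.
have [r2 r20 r2P] := ball_segment w oD Dy.
pose s := Num.min r (Num.min r1 r2).
have s0 : 0 < s by rewrite !lt_min r0 r10.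
have sP (t : R) : `|t| < s -> [/\ `|t| < r, D (x + t *: v) & D (y + t *: w)].
  by rewrite !lt_min => /and3P[? ? ?]; split => //; [exact: r1P|exact: r2P].
have dquad (t : R) : is_derive t 1 (fun u : R => c1 * u + c2 * u ^+ 2) (c1 + 2 * c2 * t).
  apply: is_derive_eq; rewrite /GRing.scale /=; ring.
have dlin (t : R) : is_derive t 1 (fun u : R => c1 + 2 * c2 * u) (2 * c2).
  apply: is_derive_eq; rewrite /GRing.scale /=; ring.
have dgrad z u : D z ->
    is_derive (0 : R) 1 (fun t : R => dot u (grad f (z + t *: u))) (hess f z u u).
  move=> Dz.
  have -> : (fun t : R => dot u (grad f (z + t *: u))) =
      \sum_(j < d) (u 0 j \*: (fun t : R => partial j f (z + t *: u))).
    by apply/funext => t; rewrite fct_sumE; apply: eq_bigr => j _; rewrite mxE.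
  rewrite /hess /dot; apply: is_derive_sum => j; rewrite mxE.
  apply: is_deriveZ; apply: line_derive; rewrite scale0r addr0.
  exact: C1_is_derive (f2D j) Dz.
pose phi (t : R) := (f (x + t *: v) - f (y + t *: w)) - (c1 * t + c2 * t ^+ 2).
pose g (t : R) := (dot v (grad f (x + t *: v)) - dot w (grad f (y + t *: w)))
   - (c1 + 2 * c2 * t).
have [] := @second_order_max phi g s (hess f x v v - hess f y w w - 2 * c2) s0.
- move=> t /sP[_ Dt Dt']; apply: is_deriveB; apply: is_deriveB.
    by apply: line_derive; exact: C1_is_derive fD Dt.
  by apply: line_derive; exact: C1_is_derive fD Dt'.
- by apply: is_deriveB; apply: is_deriveB; exact: dgrad.
- move=> t /sP[tr Dt Dt']; have := le t tr Dt Dt'.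
  rewrite /phi !scale0r !addr0 expr0n /= mulr0; lra.
- rewrite /g !scale0r !addr0 mulr0 addr0 subr_le0 => /subr0_eq g0 l0.
  by split.
Qed.

End Calculus.

(** * Domains: regularity classes, exit points, exterior balls *)

Section Geometry.
Context {R : realType} {d : nat}.
Implicit Types (D : set 'rV[R]_d) (x y z v w : 'rV[R]_d) (f : 'rV[R]_d -> R).

Lemma closure_norm D x :
  closure D x <-> forall e : R, 0 < e -> exists2 w, D w & `|x - w| < e.
Proof.
split=> [Dx e e0|h B /nbhs_ballP[e /= e0 eB]].
  have [w [Dw xw]] := Dx _ (nbhsx_ballx x e e0).
  by exists w => //; move: xw; rewrite -ball_normE.
have [w Dw xw] := h e e0; exists w; split=> //.
by apply: eB; rewrite -ball_normE.
Qed.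

Lemma boundary_open D x : open D -> (boundary D x <-> closure D x /\ ~ D x).
Proof. by move=> oD; rewrite /boundary (interior_id D).1. Qed.

Lemma within_closure_at D f g x : open D -> {within closure D, continuous g} ->
  (forall y, D y -> f y = g y) -> D x -> {for x, continuous f}.
Proof.
move=> oD /subspace_continuousP cg fg Dx W.
rewrite fg// => /(cg _ (subset_closure Dx)) gW.
have Dn : nbhs x D := open_nbhs_nbhs (conj oD Dx).
apply: (@filterS2 _ (nbhs x) _ D _ _ _ Dn gW) => y Dy h.
by rewrite /= (fg _ Dy); exact: h (subset_closure Dy).
Qed.

Lemma Ck_closure_C1 k D f s : open D -> Ck_closure k D f -> (size s < k)%N ->
  C1_on D (iter_partial s f).
Proof.
move=> oD [_ pf cf] sk i x Dx; split; first exact: pf.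
have [g [cg fg]] := cf (i :: s) sk.
exact: within_closure_at cg fg Dx.
Qed.

Lemma Ck_closure_C2 k D f : open D -> Ck_closure k D f -> (1 < k)%N -> C2_on D f.
Proof.
move=> oD cf k1; split; first exact: (Ck_closure_C1 (s := [::]) oD cf (ltnW k1)).
by move=> j; exact: (Ck_closure_C1 (s := [:: j]) oD cf k1).
Qed.

Lemma sup_order_bound j D f s x : size s = j -> D x ->
  ((`|iter_partial s f x|)%:E <= sup_order j D f)%E.
Proof. by move=> sj Dx; apply: ereal_sup_ubound; exists s, x. Qed.

Lemma sup_order_ge0 (i : 'I_d) j D f x : D x -> (0 <= sup_order j D f)%E.
Proof.
move=> Dx; apply: le_trans (@sup_order_bound j D f (nseq j i) x _ Dx).
  by rewrite lee_fin.
by rewrite size_nseq.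
Qed.

Lemma Ck_norm_bound (i : 'I_d) k D f s x : (size s <= k)%N -> D x ->
  ((`|iter_partial s f x|)%:E <= Ck_norm k D f)%E.
Proof.
move=> sk Dx; apply: (le_trans (sup_order_bound f erefl Dx)).
rewrite /Ck_norm (bigD1_seq (size s)) ?mem_index_iota ?iota_uniq//=.
by apply: leeDl; apply: sume_ge0 => j _; apply: sup_order_ge0 i _ _ _ _ Dx.
Qed.

(** Every summand of the norm is nonnegative as soon as the dimension is positive
    and the open set [D] has a point: the seminorm is then a supremum over a nonempty family of pairs of
    distinct points, and cannot be [-oo]. *)
Lemma holder_norm_bound (i : 'I_d) k alpha D f s x : open D ->
  (holder_norm k alpha D f < +oo)%E -> (size s <= k)%N -> D x ->
  `|iter_partial s f x| <= fine (holder_norm k alpha D f).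
Proof.
move=> oD hfin sk Dx.
have semi0 : (0 <= holder_seminorm k alpha D f)%E.
  have [r r0 rD] := ball_segment (delta_mx 0 i) oD Dx.
  have r2 : `|r / 2| < r by rewrite gtr0_norm ?divr_gt0// ltr_pdivrMr// ltr_pMr// ltr1n.
  have Dy := rD _ r2.
  have nxy : x != x + (r / 2) *: delta_mx 0 i.
    apply/eqP => /rowP /(_ i); rewrite !mxE !eqxx mulr1 => /eqP.
    by rewrite -subr_eq0 opprD addrA subrr sub0r oppr_eq0 mulf_eq0 invr_eq0 gt_eqF//= pnatr_eq0.
  apply: le_trans (ereal_sup_ubound _); last first.
    exists (nseq k i), x, (x + (r / 2) *: delta_mx 0 i).
    by rewrite size_nseq; split => //; reflexivity.
  by rewrite lee_fin divr_ge0// powR_ge0.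
have le : ((`|iter_partial s f x|)%:E <= holder_norm k alpha D f)%E.
  by apply: (le_trans (Ck_norm_bound i f sk Dx)); rewrite leeDl.
rewrite -lee_fin fineK// fin_numElt hfin andbT.
by apply: lt_le_trans le; rewrite ltNyr.
Qed.

Lemma enorm_le_norm x : enorm x <= d%:R * `|x|.
Proof.
have [->|x0] := eqVneq x 0.
  by rewrite enormE /dot big1 ?sqrtr0 ?mulr_ge0// => i _; rewrite mxE mul0r.
have e0 : 0 < enorm x.
  by rewrite lt_neqAle enorm_ge0 andbT eq_sym; apply: contraNneq x0 => /enorm0_eq/eqP.
rewrite -(ler_pM2r e0) -expr2 enorm_sq.
by apply: le_trans (ler_norm _) _; apply: dot_bound => i; exact: coord_le_norm.
Qed.

Lemma exit_point D x y : open D -> D x -> ~ D y ->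
  exists tau : R, [/\ 0 < tau <= 1, forall t : R, 0 <= t < tau -> D (x + t *: (y - x))
    & boundary D (x + tau *: (y - x))].
Proof.
move=> oD Dx nDy; pose A := [set t : R | 0 <= t /\ ~ D (x + t *: (y - x))].
have A1 : A 1 by split=> //; rewrite scale1r addrC subrK.
have hA : has_inf A by split; [exists 1|exists 0 => t []].
have lb t : A t -> inf A <= t by move=> At; apply: ge_inf => //; case: hA.
pose tau := inf A.
have before (t : R) : 0 <= t < tau -> D (x + t *: (y - x)).
  move=> /andP[t0 tt]; apply: contrapT => nD.
  by move: tt; rewrite ltNge lb.
have nD : ~ D (x + tau *: (y - x)).
  move=> Dtau; have [r r0 rD] := ball_segment (y - x) oD Dtau.
  have [a aA ar] := inf_adherent r0 hA; have [a0 aD] := aA; apply: aD.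
  have -> : x + a *: (y - x) = x + tau *: (y - x) + (a - tau) *: (y - x).
    by rewrite -addrA -scalerDl addrCA subrr addr0.
  apply: rD; rewrite ger0_norm ?subr_ge0; last exact: lb.
  by rewrite ltrBlDl.
have tau_ge0 : 0 <= tau by apply: lb_le_inf => //; [exists 1|move=> t []].
have tau0 : 0 < tau.
  rewrite lt_neqAle tau_ge0 andbT; apply/eqP => t0.
  by apply: nD; rewrite -t0 scale0r addr0.
exists tau; split=> //; first by rewrite tau0 lb.
apply/(boundary_open _ oD); split=> //; apply/closure_norm => e e0.
have v1 : 0 < `|y - x| + 1 by rewrite ltr_wpDl.
pose s := Num.min tau (e / (`|y - x| + 1)) / 2.
have s0 : 0 < s by rewrite divr_gt0// lt_min tau0 divr_gt0.
have : s < Num.min tau (e / (`|y - x| + 1)).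
  by rewrite /s ltr_pdivrMr ?ltr_pMr ?ltr1n// lt_min tau0 divr_gt0.
rewrite lt_min => /andP[st se].
exists (x + (tau - s) *: (y - x)).
  by apply: before; rewrite subr_ge0 ltW//= ltrBlDr ltrDl.
rewrite opprD addrACA subrr add0r -scalerBl opprB addrCA subrr addr0 normrZ gtr0_norm//.
rewrite (@le_lt_trans _ _ (s * (`|y - x| + 1)))//; last by rewrite -ltr_pdivlMr.
by rewrite ler_pM2l// lerDl.
Qed.

Lemma compact_closure D : bounded_set D -> compact (closure D).
Proof.
move=> [M [Mr MD]]; apply: bounded_closed_compact; last exact: closed_closure.
exists (M + 1); split; first by rewrite realD.
move=> N MN x /closure_norm xD /=.
have [w Dw xw] := xD (N - (M + 1)) ltac:(lra).
have := MD (M + 1) ltac:(lra) w Dw => /= wM.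
have -> : x = (x - w) + w by rewrite subrK.
have := ler_normD (x - w) w; lra.
Qed.

Lemma compact_boundary D : bounded_set D -> compact (boundary D).
Proof.
move=> bD; apply: subclosed_compact (compact_closure bD) _.
  by apply: closedI; [exact: closed_closure|apply: open_closedC; exact: open_interior].
by move=> x [].
Qed.

Lemma ball_convex x (r : R) y z (t : R) : ball x r y -> ball x r z -> 0 <= t <= 1 ->
  ball x r (y + t *: (z - y)).
Proof.
rewrite -!ball_normE /= => xy xz /andP[t0 t1].
have -> : x - (y + t *: (z - y)) = (1 - t) *: (x - y) + t *: (x - z).
  by apply/rowP => i; rewrite !mxE; ring.
apply: le_lt_trans (ler_normD _ _) _; rewrite !normrZ (ger0_norm t0) ger0_norm ?subr_ge0//.
have [->|tn0] := eqVneq t 0; first by rewrite mul0r addr0 subr0 mul1r.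
have tp : 0 < t by rewrite lt_neqAle eq_sym tn0.
have : t * `|x - z| < t * r by rewrite ltr_pM2l.
have : (1 - t) * `|x - y| <= (1 - t) * r by rewrite ler_wpM2l ?subr_ge0// ltW.
lra.
Qed.

(** The mean value theorem for [f], then the Lipschitz bound of its gradient on
    the segment; hence the factor [d * d * M] in place of [M / 2]. *)
Lemma taylor2_lower D f x y (M : R) : open D -> C2_on D f -> 0 <= M ->
  (forall i j z, D z -> `|partial i (partial j f) z| <= M) ->
  (forall t : R, 0 <= t <= 1 -> D (x + t *: (y - x))) ->
  f x + dot (y - x) (grad f x) - d%:R * d%:R * M * dot (y - x) (y - x) <= f y.
Proof.
move=> oD [fD f2D] M0 fM seg.
have [c c01 e] : exists2 c : R, 0 < c < 1 & f y - f x = dot (y - x) (grad f (x + c *: (y - x))).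
  apply: (segment_mvt oD fD); last exact: C1_segment_continuous fD seg.
  by move=> t /andP[t0 t1]; apply: seg; rewrite !ltW.
set v := y - x in e seg *.
have : `|dot v (grad f (x + c *: v) - grad f x)| <= d%:R * (d%:R * M * enorm v) * enorm v.
  apply: dot_bound => j; rewrite !mxE.
  have sub (t : R) : 0 <= t <= 1 -> D (x + t *: (x + c *: v - x)).
    move=> /andP[t0 t1]; rewrite addrAC subrr add0r scalerA; apply: seg.
    by case/andP: c01 => c0 c1; rewrite mulr_ge0 ?(ltW c0)//= mulr_ile1// ltW.
  have := @segment_lipschitz _ _ D (partial j f) x (x + c *: v) M oD (f2D j) (fun z i Dz => fM i j z Dz).
  have sub' (t : R) : 0 < t < 1 -> D (x + t *: (x + c *: v - x)).
    by move=> /andP[t0 t1]; apply: sub; rewrite !ltW.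
  move=> /(_ sub' (C1_segment_continuous oD (f2D j) sub)) /le_trans; apply.
  rewrite [x + c *: v - x]addrAC subrr add0r enormZ.
  rewrite ler_wpM2l ?mulr_ge0// ler_piMl ?enorm_ge0//.
  by case/andP: c01 => c0 c1; rewrite gtr0_norm// ltW.
rewrite dotDr dotNr -e -enorm_sq ler_norml => /andP[h _].
move: h; rewrite expr2; set E := enorm v; lra.
Qed.


End Geometry.

Section ExteriorBall.
Context {R : realType}.

Lemma dot_col' d (i : 'I_d) (x y : 'rV[R]_d) :
  dot x y = x 0 i * y 0 i + dot (col' i x) (col' i y).
Proof.
rewrite /dot (bigD1_ord i) //=; congr (_ + _); apply: eq_bigr => j _.
by rewrite !mxE.
Qed.

Lemma ball_col' d (i : 'I_d) (x y : 'rV[R]_d) r :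
  ball x r y -> ball (col' i x) r (col' i y).
Proof. by case=> r0 h; split=> // a b; rewrite !mxE; exact: h. Qed.

Lemma enorm_col' d (i : 'I_d) (x : 'rV[R]_d) : enorm (col' i x) <= enorm x.
Proof.
by apply: enorm_le; rewrite ?enorm_ge0// enorm_sq (dot_col' i) lerDr -expr2 sqr_ge0.
Qed.

Definition exterior_ball d (D : set 'rV[R]_d) (rho : R) (y : 'rV[R]_d) :=
  exists z, enorm (y - z) = rho /\ forall w, D w -> rho <= enorm (w - z).

(** Near [y], the domain lies above the paraboloid with vertex [y] whose
    curvature is bounded by the second derivatives of the graph function, and a
    small ball below the tangent plane lies under this paraboloid. Smaller radii
    also work, with [e] locally independent of [y]: this makes the statement fit
    for a compactness argument. *)
Lemma exterior_ball_chart d (D : set 'rV[R]_d) (alpha r : R) (i : 'I_d) (b : bool)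
    (gamma : 'rV[R]_(d.-1) -> R) (y0 : 'rV[R]_d) :
  (1 < d)%N -> open D -> 0 < r ->
  holder_class 4 alpha (ball (col' i y0) r) gamma ->
  (forall x, ball y0 r x -> (D x <-> gamma (col' i x) < (-1) ^+ b * x 0 i)) ->
  exists2 e : R, 0 < e & forall y rho, boundary D y -> ball y0 e y ->
     0 < rho < e -> exterior_ball D rho y.
Proof.
move=> d1 oD r0 [gC gfin] chart.
have i' : 'I_d.-1 by apply: (@Ordinal _ 0); rewrite -subn1 subn_gt0.
pose B := ball (col' i y0) r.
have oB : open B by exact: ball_open.
pose M := fine (holder_norm 4 alpha B gamma).
have gM s x : (size s <= 4)%N -> B x -> `|iter_partial s gamma x| <= M.
  exact: holder_norm_bound i' _ _ _ _ _ _ oB gfin.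
have gC2 : C2_on B gamma := Ck_closure_C2 oB gC isT.
have M0 : 0 <= M.
  by apply: le_trans (gM [::] (col' i y0) isT _); rewrite ?normr_ge0//; exact: ballxx.
pose n : R := (d.-1)%:R; pose N := n * n * M.
have n0 : 0 <= n by rewrite ler0n.
have N0 : 0 <= N by rewrite !mulr_ge0.
pose s : R := (-1) ^+ b.
have ss : s * s = 1 by rewrite -expr2 sqrr_sign.
have segB x y : B x -> B y -> forall t : R, 0 <= t <= 1 -> B (x + t *: (y - x)).
  by move=> Bx By t; apply: ball_convex.
pose e := Num.min (r / 4) (2 * N + 1)^-1.
have e0 : 0 < e by rewrite lt_min divr_gt0//= invr_gt0; lra.
exists e => // y rho /(boundary_open _ oD)[cDy nDy] yb /andP[rho0 rhoe].
have [re eN] : rho < r / 4 /\ rho * (2 * N + 1) < 1.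
  by move: rhoe; rewrite lt_min => /andP[-> h]; rewrite -ltr_pdivlMr ?div1r//; lra.
have er : e <= r / 4 by rewrite ge_min lexx.
have near_y w : enorm (w - y) < r / 2 -> ball y0 r w.
  move=> wy; move: yb; rewrite -!ball_normE /= => yb.
  have -> : y0 - w = (y0 - y) - (w - y) by rewrite opprB addrA subrK.
  have := ler_normB (y0 - y) (w - y); have := norm_le_enorm (w - y); lra.
have yr : ball y0 r y by apply: near_y; rewrite subrr -(scale0r 0) enormZ normr0 mul0r divr_gt0.
have By : B (col' i y) by exact: ball_col'.
(* [gamma <= s * y 0 i] because points of the domain accumulate at [y] and
   [gamma] is Lipschitz. *)
have ygraph : gamma (col' i y) = s * y 0 i.
  apply/eqP; rewrite eq_le; apply/andP; split; last first.
    by rewrite leNgt; apply/negP => /(chart y yr).2.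
  apply/ler_addgt0Pr => u u0.
  have K0 : 0 < d%:R * (n * M + 1) + 1.
    by rewrite ltr_wpDl// mulr_ge0// addr_ge0// mulr_ge0.
  pose t := Num.min (r / (2 * (d%:R + 1))) (u / (d%:R * (n * M + 1) + 1)).
  have d0 : 0 < 2 * (d%:R + 1) :> R by rewrite mulr_gt0// ltr_wpDl.
  have t0 : 0 < t by rewrite lt_min !divr_gt0.
  have [w Dw] := (closure_norm _ _).1 cDy t t0.
  rewrite distrC lt_min ltr_pdivlMr// ltr_pdivlMr// => /andP[wr wu].
  have dw := enorm_le_norm (w - y).
  have wyr : ball y0 r w by apply: near_y; have := normr_ge0 (w - y); lra.
  have Bw : B (col' i w) by exact: ball_col'.
  have gw := (chart w wyr).1 Dw.
  have Lip : `|gamma (col' i w) - gamma (col' i y)| <= n * M * enorm (col' i w - col' i y).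
    apply: (@segment_lipschitz _ _ B) => //; first exact: gC2.1.
    - by move=> z j Bz; apply: (gM [:: j]).
    - by move=> c /andP[c0 c1]; apply: segB; rewrite ?ltW.
    - by apply: (C1_segment_continuous oB gC2.1); exact: segB.
  have colB : col' i w - col' i y = col' i (w - y) by apply/rowP => j; rewrite !mxE.
  rewrite colB in Lip.
  have le1 : n * M * enorm (col' i (w - y)) <= n * M * enorm (w - y).
    by rewrite ler_wpM2l ?mulr_ge0// enorm_col'.
  have le2 : s * (w 0 i - y 0 i) <= enorm (w - y).
    apply: (le_trans (ler_norm _)); rewrite normrM normrX normrN1 expr1n mul1r.
    by have := coord_le_enorm (w - y) i; rewrite !mxE.
  have le3 : (n * M + 1) * enorm (w - y) <= (n * M + 1) * (d%:R * `|w - y|).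
    by rewrite ler_wpM2l// addr_ge0// mulr_ge0.
  move: Lip; rewrite ler_norml => /andP[Lip1 Lip2].
  have := normr_ge0 (w - y).
  have := gw; rewrite -/s; lra.
pose p := grad gamma (col' i y).
pose Dp := Num.sqrt (1 + dot p p).
have Dp2 : Dp ^+ 2 = 1 + dot p p by rewrite sqr_sqrtr// addr_ge0// dotxx_ge0.
have Dp1 : 1 <= Dp.
  by rewrite -[X in X <= _]sqrtr1 ler_sqrt ?lerDl ?dotxx_ge0// addr_ge0 ?dotxx_ge0.
pose nu := \row_k (if unlift i k is Some j then - p 0 j else s).
have nui : nu 0 i = s by rewrite mxE unlift_none.
have nuc : col' i nu = - p by apply/rowP => j; rewrite [LHS]mxE [LHS]mxE liftK [RHS]mxE.
have nunu : dot nu nu = Dp ^+ 2.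
  by rewrite (dot_col' i) nui nuc dotNl dotNr opprK ss Dp2.
pose c := rho / Dp.
have c0 : 0 < c by rewrite divr_gt0// (lt_le_trans ltr01).
have cD : c * Dp = rho by rewrite mulfVK// gt_eqF// (lt_le_trans ltr01).
exists (y - c *: nu); split.
  rewrite opprB addrC subrK enormZ gtr0_norm// enormE nunu sqrtr_sqr ger0_norm//.
  exact: le_trans ler01 Dp1.
move=> w Dw; rewrite leNgt; apply/negP => wz.
have e2 : enorm (w - (y - c *: nu)) ^+ 2 < rho ^+ 2.
  by rewrite ltr_pXn2r// nnegrE ?enorm_ge0// ltW.
set o := w - y in e2 *.
have wzE : w - (y - c *: nu) = o + c *: nu by rewrite opprB addrA addrAC.
have ole : enorm o < r / 2.
  have -> : o = (w - (y - c *: nu)) - c *: nu by rewrite wzE addrK.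
  apply: le_lt_trans (enorm_triangle _ _) _.
  rewrite enormN enormZ (enormE nu) nunu sqrtr_sqr !ger0_norm ?(ltW c0) ?(le_trans ler01 Dp1)//.
  rewrite cD; lra.
have wr := near_y w ole.
have gw := (chart w wr).1 Dw.
have := taylor2_lower oB gC2 M0 (fun j k z Bz => gM [:: j; k] z isT Bz)
   (segB _ _ By (ball_col' i wr)).
have -> : col' i w - col' i y = col' i o by apply/rowP => j; rewrite !mxE.
rewrite -/p -/n -/N ygraph => tay.
have oi : o 0 i = w 0 i - y 0 i by rewrite !mxE.
have onu : dot o nu = s * o 0 i - dot (col' i o) p.
  by rewrite (dot_col' i) nui nuc dotNr mulrC.
have oo : dot (col' i o) (col' i o) <= dot o o.
  by rewrite [leRHS](dot_col' i) lerDr -expr2 sqr_ge0.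
rewrite wzE in e2; clearbody o.
move: e2; rewrite enorm_sq !(dotDl, dotDr, dotZl, dotZr) (dotC nu o) nunu.
rewrite -cD exprMn.
have tay' : dot (col' i o) p - s * o 0 i < N * dot o o.
  have := ler_wpM2l N0 oo; rewrite oi; move: gw; rewrite -/s; lra.
have o0 := dotxx_ge0 o.
have cr : c <= rho by rewrite -cD ler_peMr// ltW.
rewrite onu => e2.
have : c * (dot (col' i o) p - s * o 0 i) <= c * (N * dot o o) by rewrite ler_pM2l// ltW.
have : c * (N * dot o o) <= rho * (N * dot o o) by rewrite ler_wpM2r// mulr_ge0.
have : rho * (2 * N + 1) * dot o o <= 1 * dot o o by rewrite ler_wpM2r// ltW.
have : 0 <= rho * dot o o by rewrite mulr_ge0// ltW.
move: e2; set a := dot o o; set q := dot (col' i o) p; lra.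
Qed.

(** The radius [rho] is the parameter of a covering argument on the compact
    boundary, along the filter of positive reals that tend to 0. *)
Lemma exterior_ball_uniform d (D : set 'rV[R]_d) (alpha : R) :
  (1 < d)%N -> open D -> bounded_set D -> holder_boundary 4 alpha D ->
  exists2 rho : R, 0 < rho & forall y, boundary D y -> exterior_ball D rho y.
Proof.
move=> d1 oD bD hb.
have /compact_near_coveringP /near_covering_withinP cov := compact_boundary bD.
have := cov R (0^'+) (exterior_ball D) _.
have /[swap] /[apply] : forall x, boundary D x ->
    \forall x' \near x & rho \near 0^'+, boundary D x' -> exterior_ball D rho x'.
  move=> x /hb [r [i [b [gamma [r0 gC chart]]]]].
  have [e e0 eP] := exterior_ball_chart d1 oD r0 gC chart.
  near=> x' rho => /= bx'.
  have xx' : ball x e x' by near: x'; exact: nbhsx_ballx.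
  have re : rho < e by near: rho; exact: nbhs_right_lt.
  by apply: eP => //; apply/andP; split.
move=> h; near (0 : R)^'+ => rho; exists rho => //.
by near: rho; exact: h.
Unshelve. all: by end_near. Qed.

End ExteriorBall.

(** * The operator in a frame adapted to the gradient *)

Section Operator.
Context {R : realType} {d : nat}.
Implicit Types (D : set 'rV[R]_d) (x y z v w e : 'rV[R]_d) (f G : 'rV[R]_d -> R).

Lemma line_deriveV f x v (l : R) :
  is_derive (0 : R) 1 (fun s : R => f (x + s *: v)) l -> is_derive x v f l.
Proof.
have e : (fun h : R => h^-1 *: (((fun s : R => f (x + s *: v)) \o shift (0 : R)) (h *: 1)
        - f (x + 0 *: v)))
    = (fun h : R => h^-1 *: ((f \o shift x) (h *: v) - f x)).
  apply/funext => h /=; rewrite [h%:A]mulr1; congr (_ *: (f _ - f _)).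
    by rewrite addr0 addrC.
  by rewrite scale0r addr0.
move=> [df dl]; split; first by rewrite /derivable -e.
by rewrite -dl /derive -e.
Qed.

Lemma is_derive_inv_sqrt (B : R -> R) (t b : R) : 0 < B t -> is_derive t 1 B b ->
  is_derive t 1 (fun s => (Num.sqrt (B s))^-1) (- (b / (2 * (Num.sqrt (B t)) ^+ 3))).
Proof.
move=> B0 dB; have s0 : 0 < Num.sqrt (B t) by rewrite sqrtr_gt0.
have dS : is_derive t 1 (fun s => Num.sqrt (B s)) ((2 * Num.sqrt (B t))^-1 * b).
  apply: (@is_derive1_comp _ (@Num.sqrt R) B t); exact: is_derive1_sqrt.
have nz : Num.sqrt (B t) != 0 by rewrite gt_eqF.
split; first by apply: derivableV => //; case: dS.
rewrite (deriveV (f := fun s => Num.sqrt (B s))) //.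
rewrite (derive_val (f := fun s => Num.sqrt (B s))) /GRing.scale /=.
field.
by rewrite nz.
Qed.

Lemma hess_swap u x v w :
  hess u x v w = \sum_i w 0 i * dot v (\row_j partial i (partial j u) x).
Proof.
rewrite /hess /dot.
transitivity (\sum_j \sum_i v 0 j * (w 0 i * partial i (partial j u) x)).
  apply: eq_bigr => j _; rewrite mxE mulr_sumr; apply: eq_bigr => i _.
  by rewrite [grad _ _ _ _]mxE.
rewrite exchange_big /=; apply: eq_bigr => i _; rewrite mulr_sumr.
by apply: eq_bigr => j _; rewrite mulrCA [(\row__ _) _ _]mxE.
Qed.

(** As [d_i A = p . d_i p / A] with [A^2 = eps^2 + |p|^2], the derivative of
    [1/A] produces the form [hess u x p p], divided by [A^2]. *)
Lemma divergence_flux D eps G u x : open D -> 0 < eps -> C1_on D G -> C2_on D u -> D x ->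
  A_eps eps (grad u x) *
    divergence (fun y => (G y / A_eps eps (grad u y)) *: grad u y) x =
  dot (grad G x) (grad u x) + G x * laplacian u x
  - G x / (eps ^+ 2 + dot (grad u x) (grad u x)) * hess u x (grad u x) (grad u x).
Proof.
move=> oD e0 GD [uD u2D] Dx.
pose p := grad u x.
have AE y : A_eps eps (grad u y) = Num.sqrt (eps ^+ 2 + dot (grad u y) (grad u y)).
  by rewrite /A_eps enorm_sq.
have B0 y : 0 < eps ^+ 2 + dot (grad u y) (grad u y).
  by rewrite ltr_pwDl ?dotxx_ge0// exprn_gt0.
pose A := A_eps eps p.
have A2 : A ^+ 2 = eps ^+ 2 + dot p p by rewrite /A AE sqr_sqrtr// ltW.
have A0 : A != 0 by rewrite /A AE gt_eqF// sqrtr_gt0.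
have term i : partial i (fun y => ((G y / A_eps eps (grad u y)) *: grad u y) 0 i) x =
    partial i G x * p 0 i / A + G x * partial i (partial i u) x / A
    - G x * p 0 i * dot p (\row_j partial i (partial j u) x) / A ^+ 3.
  have -> : (fun y => ((G y / A_eps eps (grad u y)) *: grad u y) 0 i) =
     (fun y => G y * (Num.sqrt (eps ^+ 2 + dot (grad u y) (grad u y)))^-1 * partial i u y).
    by apply/funext => y; rewrite !mxE AE.
  pose del : 'rV[R]_d := delta_mx 0 i.
  have x0 : x + (0 : R) *: del = x by rewrite scale0r addr0.
  have dG : is_derive (0 : R) 1 (fun s : R => G (x + s *: del)) (partial i G x).
    apply: line_derive; rewrite scale0r addr0.
    by apply: derivableP; case: (GD i x Dx).
  have dP j : is_derive (0 : R) 1 (fun s : R => partial j u (x + s *: del))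
      (partial i (partial j u) x).
    apply: line_derive; rewrite scale0r addr0.
    by apply: derivableP; case: (u2D j i x Dx).
  have dB : is_derive (0 : R) 1
      (fun s : R => eps ^+ 2 + dot (grad u (x + s *: del)) (grad u (x + s *: del)))
      (2 * dot p (\row_j partial i (partial j u) x)).
    have -> : (fun s : R => eps ^+ 2 + dot (grad u (x + s *: del)) (grad u (x + s *: del))) =
       cst (eps ^+ 2) + \sum_(j < d) ((fun s : R => partial j u (x + s *: del)) *
         (fun s : R => partial j u (x + s *: del))).
      apply/funext => s; rewrite fctE fct_sumE; congr (_ + _).
      by apply: eq_bigr => j _; rewrite !mxE.
    rewrite -[X in is_derive _ _ _ X]add0r; apply: is_deriveD.
    rewrite /dot mulr_sumr; apply: is_derive_sum => j.
    apply: is_derive_eq (is_deriveM (dP j) (dP j)) _.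
    rewrite !x0 /GRing.scale /= !mxE; ring.
  have B00 : 0 < eps ^+ 2 + dot (grad u (x + 0 *: del)) (grad u (x + 0 *: del)) by [].
  have dI := @is_derive_inv_sqrt (fun s : R =>
     eps ^+ 2 + dot (grad u (x + s *: del)) (grad u (x + s *: del))) 0 _ B00 dB.
  have dF := is_deriveM (is_deriveM dG dI) (dP i).
  have [_ dFE] := @line_deriveV (fun y => G y *
     (Num.sqrt (eps ^+ 2 + dot (grad u y) (grad u y)))^-1 * partial i u y) x del _ dF.
  
  rewrite [LHS]dFE.
  have fE (f g : R -> R) t : (f * g) t = f t * g t by [].
  rewrite fE !x0 /GRing.scale /= -!AE -/p -/A [p 0 i]mxE.
  field.
  by rewrite A0.
rewrite /divergence (eq_bigr _ (fun i _ => term i)) -/p -/A !big_split /= sumrN.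
rewrite !mulrDr mulrN -A2; congr (_ + _ - _).
- rewrite /dot mulr_sumr; apply: eq_bigr => i _; rewrite [grad G x 0 i]mxE.
  by field.
- rewrite /laplacian /divergence !mulr_sumr; apply: eq_bigr => i _.
  have -> : (fun y => grad u y 0 i) = partial i u by apply/funext => y; rewrite mxE.
  by field.
rewrite hess_swap.
rewrite !mulr_sumr; apply: eq_bigr => i _.
set a := dot _ _; set b := p 0 i.
by field.
Qed.

Lemma hess_delta u x k : hess u x (delta_mx 0 k) (delta_mx 0 k) = partial k (partial k u) x.
Proof. by rewrite /hess dot_delta mxE dot_delta mxE. Qed.

(** The projection on the orthogonal of [e] of the [k]-th axis. Summing a
    quadratic form over these [d] vectors gives its trace on the orthogonal of
    [e]. *)
Definition orth e (k : 'I_d) : 'rV[R]_d := delta_mx 0 k - e 0 k *: e.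

Lemma dot_orth e k : dot e e = 1 -> dot e (orth e k) = 0.
Proof. by move=> e1; rewrite dotDr dotNr dotZr e1 mulr1 dotC dot_delta subrr. Qed.

Lemma orth_le1 e k : dot e e = 1 -> dot (orth e k) (orth e k) <= 1.
Proof.
move=> e1; rewrite {1}/orth dotDl dotNl dotZl dot_orth// mulr0 subr0 dot_delta !mxE !eqxx.
by rewrite /= -expr2 gerBl sqr_ge0.
Qed.

Lemma hess_trace u x e : dot e e = 1 ->
  \sum_k hess u x (orth e k) (orth e k) = laplacian u x - hess u x e e.
Proof.
move=> e1.
have term k : hess u x (orth e k) (orth e k) = partial k (partial k u) x
   - e 0 k * hess u x (delta_mx 0 k) e - e 0 k * hess u x e (delta_mx 0 k)
   + e 0 k * e 0 k * hess u x e e.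
  rewrite /orth -scaleNr !(hessDl, hessDr, hessZl, hessZr) hess_delta; ring.
rewrite (eq_bigr _ (fun k _ => term k)) !big_split /= !sumrN.
have -> : \sum_k e 0 k * hess u x (delta_mx 0 k) e = hess u x e e.
  by rewrite [RHS]/hess /dot; apply: eq_bigr => k _; rewrite /hess dot_delta.
have -> : \sum_k e 0 k * hess u x e (delta_mx 0 k) = hess u x e e.
  rewrite /hess /dot.
  under eq_bigr do rewrite mulr_sumr.
  rewrite exchange_big /=; apply: eq_bigr => j _; rewrite mxE mulr_sumr.
  by apply: eq_bigr => k _; rewrite !mxE -/(dot _ _) dot_delta !mxE; ring.
rewrite -mulr_suml -/(dot e e) e1 mul1r.
have -> : laplacian u x = \sum_k partial k (partial k u) x.
  apply: eq_bigr => k _.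
  by have -> : (fun y => grad u y 0 k) = partial k u by apply/funext => y; rewrite mxE.
ring.
Qed.

(** The diffusion matrix [(nu + G) I - G p p^T / A^2] has the eigenvalue
    [nu + G] on the orthogonal of [p], and [nu + G eps^2 / (eps^2 + |p|^2)] along
    [p]; both are at least [nu] when [0 <= G]. *)
Lemma K_op_polar D eps nu G u x e (P : R) : open D -> 0 < eps -> C1_on D G -> C2_on D u ->
  D x -> dot e e = 1 -> grad u x = P *: e ->
  K_op eps nu G u x =
    (nu + G x) * (\sum_k hess u x (orth e k) (orth e k))
    + (nu + G x * (eps ^+ 2 / (eps ^+ 2 + P ^+ 2))) * hess u x e e
    + P * dot (grad G x) e.
Proof.
move=> oD e0 GD uD Dx e1 gu.
rewrite /K_op (divergence_flux oD e0 GD uD Dx) hess_trace// gu.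
rewrite !(dotZr, dotZl, hessZl, hessZr) e1 mulr1.
have nz : eps ^+ 2 + P ^+ 2 != 0 by rewrite gt_eqF// ltr_pwDl ?sqr_ge0// exprn_gt0.
rewrite -!expr2; field.
by rewrite nz.
Qed.

End Operator.

(** * The comparison profile and tests at a maximum *)

Section Profile.
Context {R : realType} {d : nat}.
Implicit Types (z v : 'rV[R]_d).

(** A concave profile of slope [K] at 0, increasing up to [1/lam], where it takes
    the value [K / (2 lam)]. Being quadratic, it makes radial displacements
    exact. *)
Definition psi (K lam r : R) : R := K * (r - lam * r ^+ 2 / 2).

Lemma psi_concave (K lam a b : R) : 0 <= K -> 0 <= lam ->
  psi K lam b <= psi K lam a + K * (1 - lam * a) * (b - a).
Proof.
move=> K0 l0; have : 0 <= K * lam * (b - a) ^+ 2 by rewrite mulr_ge0 ?sqr_ge0// mulr_ge0.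
rewrite /psi; lra.
Qed.

Lemma psi_homo (K lam a b : R) : 0 <= K -> 0 <= lam -> a <= b -> lam * b <= 1 ->
  psi K lam a <= psi K lam b.
Proof.
move=> K0 l0 ab lb; have := psi_concave b a K0 l0.
have : K * (1 - lam * b) * (a - b) <= 0.
  by apply: mulr_ge0_le0; [rewrite mulr_ge0// subr_ge0|rewrite subr_le0].
lra.
Qed.

Lemma psi_ge (K lam r : R) : 0 <= K -> 0 <= r -> lam * r <= 1 -> K / 2 * r <= psi K lam r.
Proof.
move=> K0 r0 lr; have : 0 <= K * (r * (1 - lam * r)) by rewrite !mulr_ge0// subr_ge0.
rewrite /psi expr2; lra.
Qed.

Lemma psi_end (K lam : R) : 0 < lam -> psi K lam lam^-1 = K / (2 * lam).
Proof. move=> l0; rewrite /psi; field. by rewrite gt_eqF. Qed.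

Lemma enorm_pos z : z != 0 -> 0 < enorm z.
Proof.
move=> z0; rewrite lt_neqAle enorm_ge0 andbT eq_sym.
by apply: contraNneq z0 => /enorm0_eq/eqP.
Qed.

Definition unitv z : 'rV[R]_d := (enorm z)^-1 *: z.

Lemma unitv_dot z : 0 < enorm z -> dot (unitv z) (unitv z) = 1.
Proof.
move=> z0; rewrite dotZl dotZr -enorm_sq; field.
by rewrite gt_eqF.
Qed.

Lemma unitvK z : 0 < enorm z -> z = enorm z *: unitv z.
Proof. by move=> z0; rewrite scalerA mulfV ?scale1r// gt_eqF. Qed.

(** From [2 r A <= A^2 + r^2] with [r = |z|] and [A = |z + t v|]: a quadratic
    majorant of the norm that is exact to second order for [v] orthogonal to
    [z]. *)
Lemma enorm_move z v (t : R) : 0 < enorm z ->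
  enorm (z + t *: v) <= enorm z + dot (unitv z) v * t + dot v v / (2 * enorm z) * t ^+ 2.
Proof.
move=> z0; set r := enorm z in z0 *; set A := enorm _.
have nz : r != 0 by rewrite gt_eqF.
have A2 : A ^+ 2 = r ^+ 2 + 2 * t * (r * dot (unitv z) v) + t ^+ 2 * dot v v.
  rewrite /unitv dotZl mulVKf// /A enorm_sq !(dotDl, dotDr, dotZl, dotZr) (dotC v z) /r enorm_sq.
  ring.
have h : A * (2 * r) <= A ^+ 2 + r ^+ 2.
  have := sqr_ge0 (A - r); rewrite sqrrB; lra.
rewrite -(ler_pM2r (mulr_gt0 (ltr0n R 2) z0)); apply: (le_trans h).
rewrite A2 le_eqVlt; apply/orP; left; apply/eqP; field.
by rewrite nz.
Qed.

(** A bound good enough for the gradient and for displacements orthogonal to [z].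
    It discards the concavity of the profile, which [psi_test_radial] keeps. *)
Lemma psi_test (K lam rho P : R) z v (t : R) : 0 < enorm z -> 0 <= K -> 0 <= lam ->
  lam * (enorm z - rho) <= 1 -> P = K * (1 - lam * (enorm z - rho)) ->
  psi K lam (enorm (z + t *: v) - rho) <= psi K lam (enorm z - rho)
    + P * dot (unitv z) v * t + P * (dot v v / (2 * enorm z)) * t ^+ 2.
Proof.
move=> z0 K0 l0 lr PE.
have P0 : 0 <= P by rewrite PE mulr_ge0// subr_ge0.
have := psi_concave (enorm z - rho) (enorm (z + t *: v) - rho) K0 l0.
have := ler_wpM2l P0 (enorm_move v t z0).
rewrite -PE; lra.
Qed.

Lemma psi_test_radial (K lam rho P b : R) z (t : R) : 0 < enorm z -> `|t * b| < enorm z ->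
  P = K * (1 - lam * (enorm z - rho)) ->
  psi K lam (enorm (z + t *: (b *: unitv z)) - rho) = psi K lam (enorm z - rho)
    + P * b * t + (- (K * lam * b ^+ 2 / 2)) * t ^+ 2.
Proof.
move=> z0 tb PE.
have -> : z + t *: (b *: unitv z) = (enorm z + t * b) *: unitv z.
  by rewrite [X in X + _]unitvK// scalerDl scalerA.
have e1 : enorm (unitv z) = 1 by rewrite enormE unitv_dot// sqrtr1.
rewrite enormZ e1 mulr1 ger0_norm; first by rewrite /psi PE; field.
move: tb; rewrite ltr_norml; lra.
Qed.

End Profile.

Section Tools.
Context {R : realType} {d : nat}.
Implicit Types (D : set 'rV[R]_d) (x y z v w : 'rV[R]_d).

Lemma one_point_test D (f : 'rV[R]_d -> R) x v (c1 c2 r : R) : open D -> C2_on D f -> D x ->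
  0 < r ->
  (forall t : R, `|t| < r -> D (x + t *: v) ->
    f (x + t *: v) <= f x + c1 * t + c2 * t ^+ 2) ->
  dot v (grad f x) = c1 /\ hess f x v v <= 2 * c2.
Proof.
move=> oD fD Dx r0 h.
have d0 w : dot 0 w = 0 by rewrite -(scale0r 0) dotZl mul0r.
have [] := @two_point_test _ _ D f x x v 0 c1 c2 r oD fD Dx Dx r0.
  move=> t tr Dt _; rewrite scaler0 addr0; have := h t tr Dt; lra.
by rewrite /hess !d0 !subr0.
Qed.

Lemma compact_sublevel (T : topologicalType) (B : set T) (F : T -> R) (c : R) :
  compact B -> continuous F -> compact (B `&` [set p | F p <= c]).
Proof.
move=> cB cF; apply: compact_closedI => //.
have -> : [set p | F p <= c] = F @^-1` [set r | r <= c] by [].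
by apply: closed_comp; [move=> p _; exact: cF|exact: closed_le].
Qed.

(** At [t = S] only earlier times are available; they suffice to read the sign of
    the time derivative at a maximum. *)
Lemma time_left (S : R) (U : R -> 'rV[R]_d -> R) (t : R) x : 0 < t <= S ->
  time_derivable S U t x -> time_quotient U t x @ t^'- --> time_derivative S U t x.
Proof.
move=> /andP[t0 tS] dU; apply: cvg_trans dU; apply: cvg_app => A hA.
have {}hA : \forall s \near t, s != t -> `]0, S]%classic s -> A s := hA.
change (\forall s \near t, s < t -> A s).
have h0 : \forall s \near t, 0 < s by apply: (@cvgr_gt _ _ (nbhs t) _ id t _ 0 t0); exact: cvg_id.
apply: filterS2 h0 hA => s s0 h st; apply: h; first by rewrite lt_eqF.
by rewrite /= in_itv /= s0 (le_trans (ltW st)).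
Qed.

Lemma max_time1 (S : R) (U : R -> 'rV[R]_d -> R) (t : R) x : 0 < t <= S ->
  time_derivable S U t x ->
  (forall s, 0 <= s <= S -> U s x <= U t x) -> 0 <= time_derivative S U t x.
Proof.
move=> tS dx mx; apply: (cvgr_to_ge (time_left tS dx)).
case/andP: tS => t0 tS; near=> s.
have st : s < t by near: s; exact: nbhs_left_lt.
have s0 : 0 < s by near: s; exact: nbhs_left_gt.
rewrite /time_quotient; apply: mulr_le0; first by rewrite subr_le0 mx// !ltW//= (lt_le_trans st).
by rewrite invr_le0 subr_le0 ltW.
Unshelve. all: by end_near. Qed.

Lemma max_time2 (S : R) (U : R -> 'rV[R]_d -> R) (t : R) x y : 0 < t <= S ->
  time_derivable S U t x -> time_derivable S U t y ->
  (forall s, 0 <= s <= S -> U s x - U s y <= U t x - U t y) ->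
  0 <= time_derivative S U t x - time_derivative S U t y.
Proof.
move=> tS dx dy mx; apply: (cvgr_to_ge (cvgB (time_left tS dx) (time_left tS dy))).
case/andP: tS => t0 tS; near=> s.
have st : s < t by near: s; exact: nbhs_left_lt.
have s0 : 0 < s by near: s; exact: nbhs_left_gt.
have -> : (time_quotient U t x - time_quotient U t y) s =
   ((U s x - U s y) - (U t x - U t y)) / (s - t).
  have -> : (time_quotient U t x - time_quotient U t y) s =
    (U s x - U t x) / (s - t) - (U s y - U t y) / (s - t) by [].
  by rewrite -mulrBl; congr (_ / _); ring.
apply: mulr_le0; first by rewrite subr_le0 mx// !ltW//= (lt_le_trans st).
by rewrite invr_le0 subr_le0 ltW.
Unshelve. all: by end_near. Qed.

End Tools.

(** * Boundary and interior estimates by the maximum principle *)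

(** The balance of the equation at a two-point maximum: [p1], [p2], [p3], [p4]
    stand for the tangential diffusion, radial diffusion, transport and reaction
    terms at one point, and [q1], [q2], [q3], [q4] at the other. *)
Lemma unbalanced_absurd (R : realDomainType) (p1 p2 p3 p4 q1 q2 q3 q4 a b c m : R) :
  0 <= p1 + p2 + p3 - p4 - (q1 + q2 + q3 - q4) ->
  p1 - q1 <= a -> p2 - q2 <= - b -> p3 - q3 <= c -> 0 <= p4 -> q4 <= m ->
  a + c + m < b -> False.
Proof. by lra. Qed.

Section MaximumPrinciple.
Context {R : realType} {d : nat}.
Context (D : set 'rV[R]_d) (S eps nu mu q eta : R) (H : R -> R)
  (G Lam : 'rV[R]_d -> R) (U : R -> 'rV[R]_d -> R) (g L Lm L0 K lam : R).
Context (oD : open D) (bD : bounded_set D) (S0 : 0 <= S) (eps0 : 0 < eps) (nu0 : 0 < nu)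
  (mu0 : 0 <= mu) (H01 : forall s, 0 <= H s <= 1)
  (GC1 : C1_on D G) (Gg : forall x, D x -> 0 <= G x <= g)
  (GL : forall x i, D x -> `|partial i G x| <= L)
  (LamB : forall x, D x -> 0 <= Lam x <= Lm)
  (UC2 : forall t, 0 < t <= S -> C2_on D (U t))
  (Ucont : {within `[0, S] `*` closure D, continuous (fun z : R * 'rV[R]_d => U z.1 z.2)})
  (Ut : forall t x, 0 < t <= S -> D x -> time_derivable S U t x)
  (pde : forall t x, 0 < t <= S -> D x ->
     time_derivative S U t x = K_op eps nu G (U t) x - mu * R_eta q eta H Lam x (U t x))
  (U01 : forall t x, 0 <= t <= S -> closure D x -> 0 <= U t x <= 1)
  (Ubd : forall t x, 0 <= t <= S -> boundary D x -> U t x = 0)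
  (U0L : forall x y, D x -> (forall t : R, 0 <= t < 1 -> D (x + t *: (y - x))) ->
     closure D y -> `|U 0 y - U 0 x| <= L0 * enorm (y - x)).
(* The slope [K] of the profile dominates the initial Lipschitz constant, and
   [2 * lam <= K] makes the profile exceed 1 at the end of its range. *)
Context (lam1 : 1 <= lam) (Klam : 2 * lam <= K) (KL0 : 2 * L0 <= K) (L_ge0 : 0 <= L).

Let lam0 : 0 < lam. Proof. exact: lt_le_trans lam1. Qed.
Let K0 : 0 < K. Proof. by apply: lt_le_trans Klam; rewrite mulr_gt0. Qed.

Let L0K : L0 <= K / 2. Proof. by rewrite ler_pdivlMr// mulrC. Qed.

Lemma react_ge0 t x : 0 <= t <= S -> D x -> 0 <= mu * R_eta q eta H Lam x (U t x).
Proof.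
move=> tS Dx; rewrite mulr_ge0// /R_eta mulr_ge0//.
  by case/andP: (LamB Dx).
by case/andP: (H01 ((U t x - q) / eta)).
Qed.

Lemma react_le t x : D x -> mu * R_eta q eta H Lam x (U t x) <= mu * Lm.
Proof.
move=> Dx; rewrite ler_wpM2l// /R_eta -[leRHS]mulr1.
by case/andP: (LamB Dx) => ? ?; case/andP: (H01 ((U t x - q) / eta)) => ? ?; exact: ler_pM.
Qed.

Lemma U_pos_interior t x : 0 <= t <= S -> closure D x -> 0 < U t x -> D x.
Proof.
move=> tS cx Ux; apply: contrapT => nD.
by move: Ux; rewrite Ubd ?ltxx//; apply/(boundary_open _ oD).
Qed.

Lemma psi_nonneg r : 0 <= r -> lam * r <= 1 -> 0 <= psi K lam r.
Proof.
move=> r0 lr; apply: le_trans (psi_ge (ltW K0) r0 lr).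
by rewrite mulr_ge0// divr_ge0// ltW.
Qed.

Lemma psi_end_ge1 : 1 <= psi K lam lam^-1.
Proof. by rewrite psi_end// ler_pdivlMr ?mul1r// mulr_gt0. Qed.

Lemma init_le x y : D x -> (forall t : R, 0 <= t < 1 -> D (x + t *: (y - x))) ->
  closure D y -> U 0 x - U 0 y <= L0 * enorm (x - y).
Proof.
move=> Dx seg cy; have := U0L Dx seg cy; rewrite enormBC distrC => h.
exact: le_trans (ler_norm _) h.
Qed.

Lemma flux_bound x e : D x -> dot e e = 1 -> `|dot (grad G x) e| <= d%:R * L.
Proof.
move=> Dx e1; rewrite dotC.
have -> : d%:R * L = d%:R * L * enorm e by rewrite enormE e1 sqrtr1 mulr1.
by apply: dot_bound => i; rewrite mxE; exact: GL.
Qed.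

Lemma polar_grad (p e : 'rV[R]_d) (P : R) : (forall v, dot v p = P * dot e v) -> p = P *: e.
Proof.
move=> h; apply/rowP => i; have := h (delta_mx 0 i).
by rewrite dot_delta [dot e _]dotC dot_delta => ->; rewrite [RHS]mxE.
Qed.

Lemma psi_continuous : continuous (psi K lam).
Proof.
move=> r; rewrite /psi; apply: cvgM; first exact: cvg_cst.
apply: cvgB; first exact: cvg_id.
apply: cvgM; last exact: cvg_cst.
by apply: cvgM; [exact: cvg_cst|exact: exprn_continuous].
Qed.

Section Barrier.
Context (rho : R) (z : 'rV[R]_d) (rho0 : 0 < rho)
  (far : forall w, D w -> rho <= enorm (w - z)).
Context (hlam : d%:R * (nu + g) / rho + d%:R * L < nu * lam).

Lemma far_closure w : closure D w -> rho <= enorm (w - z).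
Proof.
move=> cw; apply/ler_addgt0Pl => e e0.
have d1 : 0 < d%:R + 1 :> R by rewrite ltr_wpDl.
have [y Dy] := (closure_norm _ _).1 cw (e / (d%:R + 1)) (divr_gt0 e0 d1).
rewrite ltr_pdivlMr// => wy.
have := far Dy; have -> : y - z = (y - w) + (w - z) by rewrite addrA subrK.
move=> /le_trans /(_ (enorm_triangle _ _)) h.
have := enorm_le_norm (y - w); rewrite distrC.
have := normr_ge0 (w - y).
lra.
Qed.

(** The radial curvature [-K lam] of the barrier, multiplied by an eigenvalue at
    least [nu], outweighs the curvature [1/rho] of the spheres and the transport
    term; the reaction term has the favourable sign. *)
Lemma barrier_no_interior_max t x : 0 < t <= S -> D x -> lam * (enorm (x - z) - rho) < 1 ->
  (forall s y, 0 <= s <= S -> closure D y -> lam * (enorm (y - z) - rho) <= 1 ->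
     U s y - psi K lam (enorm (y - z) - rho) <= U t x - psi K lam (enorm (x - z) - rho)) ->
  False.
Proof.
move=> tS Dx lr mx; set r := enorm (x - z) in lr mx.
have rrho : rho <= r by exact: far.
have r0 : 0 < r by exact: lt_le_trans rrho.
have cx := subset_closure Dx.
have [e eE] : exists e, e = unitv (x - z) by exists (unitv (x - z)).
have e1 : dot e e = 1 by rewrite eE; exact: unitv_dot.
pose P := K * (1 - lam * (r - rho)).
have P0 : 0 <= P by rewrite mulr_ge0 ?subr_ge0 ?ltW.
have PK : P <= K.
  by rewrite /P ler_piMr ?(ltW K0)// lerBlDr lerDl mulr_ge0 ?subr_ge0// ltW.
have tS' : 0 <= t <= S by case/andP: tS => ? ->; rewrite ltW.
(* As [lr] is strict, short displacements stay where [mx] applies. *)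
have line (v : 'rV[R]_d) : exists2 tau : R, 0 < tau & forall s : R, `|s| < tau ->
    D (x + s *: v) -> U t (x + s *: v) <= U t x +
      (psi K lam (enorm ((x - z) + s *: v) - rho) - psi K lam (r - rho)).
  have v1 : 0 < lam * (enorm v + 1) by rewrite mulr_gt0// ltr_wpDl// enorm_ge0.
  exists ((1 - lam * (r - rho)) / (lam * (enorm v + 1))).
    by rewrite divr_gt0// subr_gt0.
  move=> s; rewrite ltr_pdivlMr// => sl Ds.
  have eq1 : x + s *: v - z = x - z + s *: v by rewrite addrAC.
  have := mx t (x + s *: v) tS' (subset_closure Ds); rewrite eq1.
  have h : lam * (enorm (x - z + s *: v) - rho) <= 1.
    have tri := enorm_triangle (x - z) (s *: v); rewrite enormZ -/r in tri.
    have : lam * enorm (x - z + s *: v) <= lam * (r + `|s| * enorm v) by rewrite ler_pM2l.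
    have : 0 <= lam * `|s| by rewrite mulr_ge0// ltW.
    lra.
  move=> /(_ h); lra.
have test v : dot v (grad (U t) x) = P * dot e v /\ hess (U t) x v v <= P * (dot v v / r).
  have [tau tau0 tauP] := line v.
  have [] := @one_point_test _ _ D (U t) x v (P * dot e v) (P * (dot v v / (2 * r))) tau
     oD (UC2 tS) Dx tau0.
    move=> s st Ds; apply: (le_trans (tauP s st Ds)).
    have := psi_test v s r0 (ltW K0) (ltW lam0) (ltW lr) (erefl P).
    rewrite -/r -eE; lra.
  move=> -> hv; split=> //; apply: (le_trans hv).
  by rewrite le_eqVlt; apply/orP; left; apply/eqP; field; rewrite gt_eqF.
have gradE : grad (U t) x = P *: e by apply: polar_grad => v; case: (test v).
have radial : hess (U t) x e e <= - (K * lam).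
  have [tau tau0 tauP] := line e.
  have m0 : 0 < Num.min tau r by rewrite lt_min tau0.
  have [] := @one_point_test _ _ D (U t) x e P (- (K * lam / 2)) (Num.min tau r)
     oD (UC2 tS) Dx m0.
    move=> s; rewrite lt_min => /andP[st sr] Ds; apply: (le_trans (tauP s st Ds)).
    have sr1 : `|s * 1| < r by rewrite mulr1.
    have := psi_test_radial r0 sr1 (erefl P); rewrite scale1r -eE -/r => ->.
    rewrite expr1n; lra.
  by move=> _ h; apply: (le_trans h); rewrite le_eqVlt; apply/orP; left; apply/eqP; field.
have := max_time1 tS (Ut tS Dx).
have mt s : 0 <= s <= S -> U s x <= U t x.
  by move=> sS; have := mx s x sS cx (ltW lr); rewrite -/r lerD2r.
move=> /(_ mt); rewrite pde// (K_op_polar nu oD eps0 GC1 (UC2 tS) Dx e1 gradE).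
have [G0 Gle] := andP (Gg Dx).
have sumle : \sum_k hess (U t) x (orth e k) (orth e k) <= d%:R * (K / rho).
  rewrite mulr_natl -[X in _ <= _ *+ X]card_ord -sumr_const; apply: ler_sum => k _.
  have [_ h] := test (orth e k); apply: (le_trans h).
  rewrite (@le_trans _ _ (P / r))//.
    by rewrite ler_wpM2l// ler_piMl ?invr_ge0 ?(ltW r0)// orth_le1.
  by rewrite ler_pM// ?invr_ge0 ?(ltW r0)// lef_pV2.
set kap := eps ^+ 2 / _.
have kap0 : 0 <= kap by rewrite divr_ge0 ?addr_ge0 ?sqr_ge0.
have t1 : (nu + G x) * (\sum_k hess (U t) x (orth e k) (orth e k)) <= (nu + g) * (d%:R * (K / rho)).
  have h0 : 0 <= d%:R * (K / rho) by rewrite mulr_ge0// divr_ge0// ltW.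
  apply: (@le_trans _ _ ((nu + G x) * (d%:R * (K / rho)))).
    by rewrite ler_wpM2l// addr_ge0// ltW.
  by rewrite ler_wpM2r// lerD2l.
have t2 : (nu + G x * kap) * hess (U t) x e e <= - (nu * (K * lam)).
  have Gk : 0 <= G x * kap by rewrite mulr_ge0.
  have KL : 0 <= K * lam by rewrite mulr_ge0// ltW.
  apply: (@le_trans _ _ ((nu + G x * kap) * - (K * lam))).
    by rewrite ler_wpM2l// addr_ge0// ltW.
  have : 0 <= G x * kap * (K * lam) by rewrite mulr_ge0.
  lra.
have t3 : P * dot (grad G x) e <= K * (d%:R * L).
  have := flux_bound Dx e1; rewrite ler_norml => /andP[_ h].
  apply: (@le_trans _ _ (P * (d%:R * L))); first by rewrite ler_wpM2l.
  by rewrite ler_wpM2r// mulr_ge0.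
have := react_ge0 tS' Dx.
have : K * (d%:R * (nu + g) / rho + d%:R * L) < K * (nu * lam) by rewrite ltr_pM2l.
lra.
Qed.

(** At time 0, the segment from [y] to the center [z] leaves [D] at a boundary
    point whose distance to [y] is at most [|y - z| - rho], since it lies outside
    the ball; there the initial datum vanishes. *)
Lemma barrier_estimate t x : 0 <= t <= S -> closure D x -> lam * (enorm (x - z) - rho) <= 1 ->
  U t x <= psi K lam (enorm (x - z) - rho).
Proof.
move=> tS cx lr; rewrite leNgt; apply/negP => bad.
pose F (p : R * 'rV[R]_d) := lam * (enorm (p.2 - z) - rho).
have encont : continuous (fun p : R * 'rV[R]_d => enorm (p.2 - z)).
  move=> p; apply: (@continuous_comp _ _ _ (fun p : R * 'rV[R]_d => p.2 - z) (@enorm R d)).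
    by apply: cvgB; [exact: cvg_snd|exact: cvg_cst].
  exact: enorm_continuous.
have Fcont : continuous F.
  by move=> p; apply: cvgM; [exact: cvg_cst|apply: cvgB; [exact: encont|exact: cvg_cst]].
pose A := (`[0, S]%classic `*` closure D) `&` [set p | F p <= 1].
have cA : compact A.
  apply: compact_sublevel => //; apply: compact_setX; first exact: segment_compact.
  exact: compact_closure.
have A0 : A !=set0.
  by exists (t, x); split => //=; split => //=; rewrite in_itv.
pose Z (p : R * 'rV[R]_d) := U p.1 p.2 - psi K lam (enorm (p.2 - z) - rho).
have ZC : {within A, continuous Z}.
  have UA : {within A, continuous (fun p : R * 'rV[R]_d => U p.1 p.2)}.
    by apply: continuous_subspaceW Ucont => p [].
  apply: within_continuousB => //; apply: continuous_subspaceT => p.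
  apply: (@continuous_comp _ _ _ (fun p : R * 'rV[R]_d => enorm (p.2 - z) - rho) (psi K lam)).
    by apply: cvgB; [exact: encont|exact: cvg_cst].
  exact: psi_continuous.
have [[s y]] := compact_EVT_max A0 cA ZC.
rewrite inE => -[[/= sI cy] Fy] mx.
have sS : 0 <= s <= S by move: sI; rewrite in_itv.
have mx' s' y' : 0 <= s' <= S -> closure D y' -> lam * (enorm (y' - z) - rho) <= 1 ->
    U s' y' - psi K lam (enorm (y' - z) - rho) <= U s y - psi K lam (enorm (y - z) - rho).
  by move=> h1 h2 h3; apply: (mx (s', y')); rewrite inE; split => //=; split => //=; rewrite in_itv.
have Zpos : 0 < U s y - psi K lam (enorm (y - z) - rho).
  by apply: lt_le_trans (mx' t x tS cx lr); rewrite subr_gt0.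
have ry : 0 <= enorm (y - z) - rho by rewrite subr_ge0 far_closure.
have psi0 := psi_nonneg ry Fy.
have Dy : D y by apply: U_pos_interior sS cy _; lra.
have Fy1 : lam * (enorm (y - z) - rho) < 1.
  rewrite lt_neqAle Fy andbT; apply/eqP => F1.
  have e1 : enorm (y - z) - rho = lam^-1.
    by rewrite -[LHS](mulKf (lt0r_neq0 lam0)) F1 mulr1.
  have := psi_end_ge1; have /andP[_] := U01 sS cy; move: Zpos; rewrite e1; lra.
have [s0|s0] := eqVneq s 0; last first.
  apply: (@barrier_no_interior_max s y) => //.
  by case/andP: sS => ? ?; apply/andP; split=> //; rewrite lt_neqAle eq_sym s0.
have nDz : ~ D z.
  by move=> /far; rewrite subrr -(scale0r 0) enormZ normr0 mul0r leNgt rho0.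
have [tau [/andP[tau0 tau1] seg bdy]] := exit_point oD Dy nDz.
set y' := y + tau *: (z - y) in bdy.
have cy' := (boundary_open _ oD).1 bdy.
have := @init_le y y' Dy; rewrite (Ubd _ bdy) ?lexx// subr0 => /(_ _ cy'.1) h.
have {}h : U 0 y <= L0 * enorm (y - y').
  apply: h => c /andP[c0 c1]; rewrite /y' addrAC subrr add0r scalerA; apply: seg.
  by rewrite mulr_ge0 ?(ltW tau0)//= -[ltRHS]mul1r ltr_pM2r.
have e1 : enorm (y - y') = tau * enorm (y - z).
  by rewrite /y' opprD addrA subrr add0r enormN enormZ gtr0_norm// enormBC.
have e2 : enorm (y' - z) = (1 - tau) * enorm (y - z).
  have -> : y' - z = (1 - tau) *: (y - z) by apply/rowP => i; rewrite !mxE; ring.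
  by rewrite enormZ ger0_norm// subr_ge0.
have := far_closure cy'.1; rewrite e2 => h2.
have : enorm (y - y') <= enorm (y - z) - rho by rewrite e1; lra.
have := psi_ge (ltW K0) ry Fy.
move: Zpos; rewrite s0 => Zpos h3 h4.
have : L0 * enorm (y - y') <= K / 2 * (enorm (y - z) - rho).
  apply: (@le_trans _ _ (K / 2 * enorm (y - y'))).
    by apply: ler_wpM2r; [exact: enorm_ge0|exact: L0K].
  by rewrite ler_wpM2l// divr_ge0// ltW.
lra.
Qed.

End Barrier.

Section TwoPoint.
Context (hlam : d%:R * (d%:R * L) ^+ 2 / (4 * nu) + 2 * (d%:R * L) + mu * Lm < 4 * nu * lam).

Lemma G_lipschitz x y : D x -> D y -> (forall c : R, 0 <= c <= 1 -> D (x + c *: (y - x))) ->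
  `|G x - G y| <= d%:R * L * enorm (x - y).
Proof.
move=> Dx Dy seg; rewrite distrC enormBC.
apply: (segment_lipschitz oD GC1) => //.
- by move=> c /andP[c0 c1]; apply: seg; rewrite !ltW.
- exact: C1_segment_continuous GC1 seg.
Qed.

(** Opposite displacements [b e] and [- b' e] with [b], [b'] the square roots of
    the radial eigenvalues change [|x - y|] at speed [b + b' >= 2 sqrt nu]: this
    is where the concavity of the profile acts. Displacements [a w] and [a' w]
    orthogonal to [e], with the tangential square roots, see only the difference
    [a - a'], which is at most [d L |x - y| / (2 sqrt nu)]. *)
Lemma two_point_no_interior_max t x y : 0 < t <= S -> D x -> D y ->
  (forall c : R, 0 <= c <= 1 -> D (x + c *: (y - x))) ->
  0 < enorm (x - y) -> lam * enorm (x - y) < 1 ->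
  (forall s x' y', 0 <= s <= S -> closure D x' -> closure D y' -> lam * enorm (x' - y') <= 1 ->
     U s x' - U s y' - psi K lam (enorm (x' - y'))
       <= U t x - U t y - psi K lam (enorm (x - y))) ->
  False.
Proof.
move=> tS Dx Dy seg r0 lr mx; set r := enorm (x - y) in r0 lr mx.
have cx := subset_closure Dx; have cy := subset_closure Dy.
have [e eE] : exists e, e = unitv (x - y) by exists (unitv (x - y)).
have e1 : dot e e = 1 by rewrite eE; exact: unitv_dot.
pose P := K * (1 - lam * r).
have P0 : 0 <= P by rewrite mulr_ge0 ?subr_ge0 ?ltW.
have PK : P <= K.
  by rewrite /P ler_piMr ?(ltW K0)// lerBlDr lerDl mulr_ge0// ltW.
have r1 : r <= 1.
  have : 0 <= (lam - 1) * r by rewrite mulr_ge0 ?subr_ge0// ltW.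
  by move: lr; lra.
have tS' : 0 <= t <= S by case/andP: tS => ? ->; rewrite ltW.
have PE : P = K * (1 - lam * (r - 0)) by rewrite subr0.
have line (v w : 'rV[R]_d) : exists2 tau : R, 0 < tau & forall s : R, `|s| < tau ->
    D (x + s *: v) -> D (y + s *: w) -> U t (x + s *: v) - U t (y + s *: w) <= U t x - U t y +
      (psi K lam (enorm ((x - y) + s *: (v - w)) - 0) - psi K lam (r - 0)).
  have v1 : 0 < lam * (enorm (v - w) + 1) by rewrite mulr_gt0// ltr_wpDl// enorm_ge0.
  exists ((1 - lam * r) / (lam * (enorm (v - w) + 1))).
    by rewrite divr_gt0// subr_gt0.
  move=> s; rewrite ltr_pdivlMr// => sl Ds Ds'; rewrite !subr0.
  have eq1 : x + s *: v - (y + s *: w) = x - y + s *: (v - w).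
    by rewrite scalerBr opprD addrACA.
  have := mx t (x + s *: v) (y + s *: w) tS' (subset_closure Ds) (subset_closure Ds').
  rewrite eq1.
  have h : lam * enorm (x - y + s *: (v - w)) <= 1.
    have tri := enorm_triangle (x - y) (s *: (v - w)); rewrite enormZ -/r in tri.
    have : lam * enorm (x - y + s *: (v - w)) <= lam * (r + `|s| * enorm (v - w)).
      by rewrite ler_pM2l.
    have : 0 <= lam * `|s| by rewrite mulr_ge0// ltW.
    lra.
  move=> /(_ h); lra.
have test v w : dot v (grad (U t) x) - dot w (grad (U t) y) = P * dot e (v - w) /\
    hess (U t) x v v - hess (U t) y w w <= P * (dot (v - w) (v - w) / r).
  have [tau tau0 tauP] := line v w.
  have [] := @two_point_test _ _ D (U t) x y v w (P * dot e (v - w))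
     (P * (dot (v - w) (v - w) / (2 * r))) tau oD (UC2 tS) Dx Dy tau0.
    move=> s st Ds Ds'; apply: (le_trans (tauP s st Ds Ds')).
    have lr' : lam * (r - 0) <= 1 by rewrite subr0 ltW.
    have := psi_test (v - w) s r0 (ltW K0) (ltW lam0) lr' PE.
    rewrite -/r -eE; lra.
  move=> -> hv; split=> //; apply: (le_trans hv).
  by rewrite le_eqVlt; apply/orP; left; apply/eqP; field; rewrite gt_eqF.
have dot0 w : dot 0 w = 0 by rewrite -(scale0r 0) dotZl mul0r.
have gradx : grad (U t) x = P *: e.
  by apply: polar_grad => v; have [h _] := test v 0; rewrite dot0 !subr0 in h.
have grady : grad (U t) y = P *: e.
  apply: polar_grad => v; have [h _] := test 0 v.
  by rewrite dot0 !sub0r dotNr mulrN in h; apply: oppr_inj.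
have radial (b b' : R) : b * (b * hess (U t) x e e) - b' * (b' * hess (U t) y e e)
    <= - (K * lam * (b + b') ^+ 2).
  have [tau tau0 tauP] := line (b *: e) (- b' *: e).
  have bb : 0 < `|b + b'| + 1 by rewrite ltr_wpDl.
  have m0 : 0 < Num.min tau (r / (`|b + b'| + 1)) by rewrite lt_min tau0 divr_gt0.
  have [] := @two_point_test _ _ D (U t) x y (b *: e) (- b' *: e) (P * (b + b'))
    (- (K * lam * (b + b') ^+ 2 / 2)) (Num.min tau (r / (`|b + b'| + 1)))
     oD (UC2 tS) Dx Dy m0.
    move=> s; rewrite lt_min ltr_pdivlMr// => /andP[st sr] Ds Ds'.
    apply: (le_trans (tauP s st Ds Ds')).
    have sr1 : `|s * (b + b')| < r.
      by apply: le_lt_trans sr; rewrite normrM ler_wpM2l// lerDl.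
    have := psi_test_radial r0 sr1 PE; rewrite -eE -(scalerBl b (- b') e) opprK -/r => ->; lra.
  move=> _; rewrite !(hessZl, hessZr).
  rewrite !(mulNr b') mulrN opprK => h; apply: (le_trans h).
  by rewrite le_eqVlt; apply/orP; left; apply/eqP; field.
have := max_time2 tS (Ut tS Dx) (Ut tS Dy).
have mt s : 0 <= s <= S -> U s x - U s y <= U t x - U t y.
  by move=> sS; have := mx s x y sS cx cy (ltW lr); rewrite -/r lerD2r.
move=> /(_ mt); rewrite !pde//.
rewrite (K_op_polar nu oD eps0 GC1 (UC2 tS) Dx e1 gradx) (K_op_polar nu oD eps0 GC1 (UC2 tS) Dy e1 grady).
have [Gx0 Gxg] := andP (Gg Dx); have [Gy0 Gyg] := andP (Gg Dy).
set kap := eps ^+ 2 / _.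
have kap0 : 0 <= kap by rewrite divr_ge0 ?addr_ge0 ?sqr_ge0.
have nuG w : 0 <= w -> nu <= nu + w by rewrite lerDl.
have Gxk : 0 <= G x * kap by rewrite mulr_ge0.
have Gyk : 0 <= G y * kap by rewrite mulr_ge0.
pose n := Num.sqrt nu.
have sqn : n * n = nu by rewrite -expr2 sqr_sqrtr// ltW.
have n0 : 0 <= n by exact: sqrtr_ge0.
have root w : 0 <= w -> exists2 a : R, a * a = nu + w & n <= a.
  move=> w0; exists (Num.sqrt (nu + w)).
    by rewrite -expr2 sqr_sqrtr// addr_ge0// ltW.
  by rewrite ler_sqrt ?lerDl// addr_ge0// ltW.
(* Square roots of the eigenvalues of the diffusion matrices at [x] and [y]. *)
have [a a2 an] := root _ Gx0; have [a' a'2 a'n] := root _ Gy0.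
have [b b2 bn] := root _ Gxk; have [b' b'2 b'n] := root _ Gyk.
have alip : (a - a') ^+ 2 * (4 * nu) <= (d%:R * L) ^+ 2 * r.
  have s1 : 4 * nu <= (a + a') ^+ 2.
    have : n * n <= a * a' by rewrite ler_pM.
    have : n * n <= a * a by rewrite ler_pM.
    have : n * n <= a' * a' by rewrite ler_pM.
    rewrite sqn expr2; lra.
  apply: (@le_trans _ _ ((a - a') ^+ 2 * (a + a') ^+ 2)).
    by rewrite ler_wpM2l// sqr_ge0.
  rewrite -exprMn -subr_sqr !expr2 a2 a'2 opprD addrACA subrr add0r.
  have h := G_lipschitz Dx Dy seg.
  have dL0 : 0 <= d%:R * L by rewrite mulr_ge0.
  rewrite -expr2 -real_normK ?num_real//.
  apply: (@le_trans _ _ ((d%:R * L * r) ^+ 2)).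
    by rewrite ler_pXn2r ?nnegrE// mulr_ge0// ltW.
  rewrite exprMn expr2 ler_wpM2l ?mulr_ge0// expr2.
  by rewrite ler_piMl// ltW.
have bb : 4 * nu <= (b + b') ^+ 2.
  have : n * n <= b * b' by rewrite ler_pM.
  have : n * n <= b * b by rewrite ler_pM.
  have : n * n <= b' * b' by rewrite ler_pM.
  rewrite sqn expr2; lra.
have t1 : (nu + G x) * (\sum_k hess (U t) x (orth e k) (orth e k)) -
    (nu + G y) * (\sum_k hess (U t) y (orth e k) (orth e k))
    <= K * (d%:R * (d%:R * L) ^+ 2 / (4 * nu)).
  rewrite !mulr_sumr -sumrB.
  apply: (@le_trans _ _ (\sum_(k < d) K * ((d%:R * L) ^+ 2 / (4 * nu)))); last first.
    rewrite sumr_const card_ord -mulr_natl le_eqVlt; apply/orP; left; apply/eqP.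
    by field; rewrite gt_eqF.
  apply: ler_sum => k _.
  move: (orth e k) (orth_le1 k e1) => w w1.
  have [_ h] := test (a *: w) (a' *: w); move: h.
  rewrite !hessZl !hessZr -(scalerBl a a' w) dotZl dotZr.
  rewrite (mulrA a a) (mulrA a' a') (mulrA (a - a') (a - a')) a2 a'2 -expr2 => h.
  apply: (le_trans h); apply: (@le_trans _ _ (P * ((a - a') ^+ 2 / r))).
    rewrite ler_wpM2l// ler_wpM2r ?invr_ge0 ?(ltW r0)//.
    by rewrite ler_piMr// sqr_ge0.
  have h1 : (a - a') ^+ 2 / r <= (d%:R * L) ^+ 2 / (4 * nu).
    by rewrite ler_pdivrMr// mulrAC ler_pdivlMr// mulr_gt0.
  apply: (@le_trans _ _ (P * ((d%:R * L) ^+ 2 / (4 * nu)))); first by rewrite ler_wpM2l.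
  by rewrite ler_wpM2r// divr_ge0 ?sqr_ge0// mulr_ge0// ltW.
have t2 : (nu + G x * kap) * hess (U t) x e e - (nu + G y * kap) * hess (U t) y e e
    <= - (K * (4 * nu * lam)).
  have := radial b b'; rewrite (mulrA b b) (mulrA b' b') b2 b'2 => h; apply: (le_trans h).
  have -> : K * (4 * nu * lam) = K * lam * (4 * nu) by ring.
  by rewrite lerN2 ler_wpM2l// mulr_ge0// ltW.
have t3 : P * dot (grad G x) e - P * dot (grad G y) e <= K * (2 * (d%:R * L)).
  have := flux_bound Dx e1; rewrite ler_norml => /andP[_ hx].
  have := flux_bound Dy e1; rewrite ler_norml => /andP[hy _].
  rewrite -mulrBr; apply: (@le_trans _ _ (P * (2 * (d%:R * L)))).
    by rewrite ler_wpM2l// mulr_natl mulr2n; apply: lerD => //; rewrite lerNl.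
  by rewrite ler_wpM2r// !mulr_ge0.
have rx := react_ge0 tS' Dx.
have ry := react_le t Dy.
have mL : mu * Lm <= K * (mu * Lm).
  rewrite ler_peMl//; last first.
    by apply: le_trans Klam; apply: (le_trans lam1); rewrite ler_peMl ?ler1n// ltW.
  by rewrite mulr_ge0//; case/andP: (LamB Dx); exact: le_trans.
have hK : K * (d%:R * (d%:R * L) ^+ 2 / (4 * nu)) + K * (2 * (d%:R * L)) + K * (mu * Lm)
    < K * (4 * nu * lam) by rewrite -!mulrDr ltr_pM2l.
move=> h; exact: unbalanced_absurd h t1 t2 t3 rx (le_trans ry mL) hK.
Qed.

Context (rho : R) (rho0 : 0 < rho) (ext : forall y, boundary D y -> exterior_ball D rho y)
  (hlamB : d%:R * (nu + g) / rho + d%:R * L < nu * lam).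

(** [|x - z| - rho <= |x - y|] for the exterior ball at [y], and the profile is
    increasing. *)
Lemma boundary_gradient t x y : 0 <= t <= S -> closure D x -> boundary D y ->
  lam * enorm (x - y) <= 1 -> U t x <= psi K lam (enorm (x - y)).
Proof.
move=> tS cx bdy lxy.
have [z [zr far]] := ext bdy.
have le : enorm (x - z) - rho <= enorm (x - y).
  rewrite lerBlDr -zr; have -> : x - z = (x - y) + (y - z) by rewrite addrA subrK.
  exact: enorm_triangle.
have lz : lam * (enorm (x - z) - rho) <= 1.
  by apply: le_trans lxy; rewrite ler_pM2l.
apply: (le_trans (barrier_estimate rho0 far hlamB tS cx lz)).
exact: psi_homo (ltW K0) (ltW lam0) le lxy.
Qed.

Lemma two_point_estimate t x y : 0 <= t <= S -> closure D x -> closure D y ->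
  lam * enorm (x - y) <= 1 -> U t x - U t y <= psi K lam (enorm (x - y)).
Proof.
move=> tS cx cy lr; rewrite leNgt; apply/negP => bad.
pose F (p : R * ('rV[R]_d * 'rV[R]_d)) := lam * enorm (p.2.1 - p.2.2).
have c21 : continuous (fun p : R * ('rV[R]_d * 'rV[R]_d) => p.2.1).
  move=> p; apply: (@continuous_comp _ _ _ (fun p : R * ('rV[R]_d * 'rV[R]_d) => p.2) fst).
    exact: cvg_snd.
  exact: cvg_fst.
have c22 : continuous (fun p : R * ('rV[R]_d * 'rV[R]_d) => p.2.2).
  move=> p; apply: (@continuous_comp _ _ _ (fun p : R * ('rV[R]_d * 'rV[R]_d) => p.2) snd).
    exact: cvg_snd.
  exact: cvg_snd.
have encont : continuous (fun p : R * ('rV[R]_d * 'rV[R]_d) => enorm (p.2.1 - p.2.2)).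
  move=> p; apply: (@continuous_comp _ _ _ (fun p : R * ('rV[R]_d * 'rV[R]_d) => p.2.1 - p.2.2)
     (@enorm R d)).
    by apply: cvgB; [exact: c21|exact: c22].
  exact: enorm_continuous.
have Fcont : continuous F.
  by move=> p; apply: cvgM; [exact: cvg_cst|exact: encont].
pose A := (`[0, S]%classic `*` (closure D `*` closure D)) `&` [set p | F p <= 1].
have cA : compact A.
  apply: compact_sublevel => //; apply: compact_setX; first exact: segment_compact.
  by apply: compact_setX; exact: compact_closure.
have A0 : A !=set0.
  by exists (t, (x, y)); split => //=; split => //=; rewrite in_itv.
pose Z (p : R * ('rV[R]_d * 'rV[R]_d)) :=
  U p.1 p.2.1 - U p.1 p.2.2 - psi K lam (enorm (p.2.1 - p.2.2)).
have ZC : {within A, continuous Z}.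
  have U1 : {within A, continuous (fun p : R * ('rV[R]_d * 'rV[R]_d) => U p.1 p.2.1)}.
    apply: (@within_comp _ _ _ A _ (fun p : R * ('rV[R]_d * 'rV[R]_d) => (p.1, p.2.1))
       (fun z : R * 'rV[R]_d => U z.1 z.2) _ _ Ucont).
      apply: continuous_subspaceT => p.
      have h1 : fst q @[q --> p] --> p.1 by exact: cvg_fst.
      exact: cvg_pair h1 (c21 p).
    by move=> p [[/= ? [? ?]] _].
  have U2 : {within A, continuous (fun p : R * ('rV[R]_d * 'rV[R]_d) => U p.1 p.2.2)}.
    apply: (@within_comp _ _ _ A _ (fun p : R * ('rV[R]_d * 'rV[R]_d) => (p.1, p.2.2))
       (fun z : R * 'rV[R]_d => U z.1 z.2) _ _ Ucont).
      apply: continuous_subspaceT => p.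
      have h1 : fst q @[q --> p] --> p.1 by exact: cvg_fst.
      exact: cvg_pair h1 (c22 p).
    by move=> p [[/= ? [? ?]] _].
  apply: within_continuousB; first exact: within_continuousB.
  apply: continuous_subspaceT => p.
  apply: (@continuous_comp _ _ _ (fun p : R * ('rV[R]_d * 'rV[R]_d) => enorm (p.2.1 - p.2.2))
    (psi K lam)); [exact: encont|exact: psi_continuous].
have [[s [x' y']]] := compact_EVT_max A0 cA ZC.
rewrite inE => -[[/= sI [cx' cy']] Fy] mx.
rewrite /F /= in Fy.
have sS : 0 <= s <= S by move: sI; rewrite in_itv.
have mx' s1 x1 y1 : 0 <= s1 <= S -> closure D x1 -> closure D y1 -> lam * enorm (x1 - y1) <= 1 ->
    U s1 x1 - U s1 y1 - psi K lam (enorm (x1 - y1))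
     <= U s x' - U s y' - psi K lam (enorm (x' - y')).
  by move=> h1 h2 h3 h4; apply: (mx (s1, (x1, y1))); rewrite inE; split => //=; split => //=; rewrite in_itv.
have Zpos : 0 < U s x' - U s y' - psi K lam (enorm (x' - y')).
  by apply: lt_le_trans (mx' t x y tS cx cy lr); rewrite subr_gt0.
set r := enorm (x' - y') in Fy mx' Zpos.
have r_ge0 : 0 <= r by exact: enorm_ge0.
have psi0 := psi_nonneg r_ge0 Fy.
have [Uy0 Uy1] := andP (U01 sS cy'); have [Ux0 Ux1] := andP (U01 sS cx').
have Dx : D x' by apply: U_pos_interior sS cx' _; lra.
(* A boundary point on the segment would contradict [Zpos], by the boundary
   estimate. *)
have seg c : 0 <= c <= 1 -> D (x' + c *: (y' - x')).
  move=> /andP[c0 c1]; apply: contrapT => nD.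
  have [tau [/andP[tau0 tau1] _]] := exit_point oD Dx nD.
  rewrite addrAC subrr add0r scalerA; set w := x' + _ => bdw.
  have ew : enorm (x' - w) = tau * c * r.
    by rewrite /w opprD addrA subrr add0r enormN enormZ /r enormBC ger0_norm// mulr_ge0// ltW.
  have wr : enorm (x' - w) <= r.
    by rewrite ew ler_piMl// mulr_ile1// ltW.
  have lw : lam * enorm (x' - w) <= 1 by apply: le_trans Fy; rewrite ler_pM2l.
  have := boundary_gradient sS cx' bdw lw.
  have := psi_homo (ltW K0) (ltW lam0) wr Fy; lra.
have Dy : D y' by have := seg 1; rewrite scale1r addrC subrK lexx ler01 => /(_ isT).
have r0 : 0 < r.
  rewrite lt_neqAle r_ge0 andbT eq_sym; apply/eqP => re0.
  by move: Zpos; rewrite re0 (subr0_eq (enorm0_eq re0)) subrr /psi; lra.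
have Fy1 : lam * r < 1.
  rewrite lt_neqAle Fy andbT; apply/eqP => F1.
  have e1 : r = lam^-1.
    by rewrite -[LHS](mulKf (lt0r_neq0 lam0)) F1 mulr1.
  have := psi_end_ge1; move: Zpos; rewrite e1; lra.
have [s0|s0] := eqVneq s 0; last first.
  apply: (@two_point_no_interior_max s x' y') => //.
  by case/andP: sS => ? ?; apply/andP; split=> //; rewrite lt_neqAle eq_sym s0.
have := @init_le x' y' Dx; rewrite -/r => /(_ _ cy') h.
have {}h : U 0 x' - U 0 y' <= L0 * r.
  by apply: h => c /andP[c0 c1]; apply: seg; rewrite c0 ltW.
have := psi_ge (ltW K0) r_ge0 Fy.
have : L0 * r <= K / 2 * r by apply: ler_wpM2r => //; exact: L0K.
move: Zpos; rewrite s0; lra.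
Qed.

(** The two-point estimate for [x + h e] and [x], with [e] the direction of the
    gradient, bounds the derivative in that direction. *)
Lemma gradient_bound t x : 0 < t <= S -> D x -> enorm (grad (U t) x) <= K.
Proof.
move=> tS Dx.
have tS' : 0 <= t <= S by case/andP: tS => ? ->; rewrite ltW.
set p := grad (U t) x.
have [->|p0] := eqVneq p 0.
  by rewrite -(scale0r 0) enormZ normr0 mul0r ltW.
have ep := enorm_pos p0.
pose e := unitv p.
have e1 : enorm e = 1 by rewrite enormE unitv_dot// sqrtr1.
have pe : enorm p = dot e p.
  by rewrite dotZl -enorm_sq expr2 mulKf// gt_eqF.
have [r r0 rD] := ball_segment e oD Dx.
have [dU dUE] := C1_is_derive e oD (UC2 tS).1 Dx.
rewrite pe -dUE.
have lim : (fun h => h^-1 *: ((U t \o shift x) (h *: e) - U t x)) @ 0^'+ --> 'D_e (U t) x.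
  apply: cvg_trans dU; apply: cvg_app => A hA.
  have {}hA : \forall s \near (0 : R), s != 0 -> A s := hA.
  change (\forall s \near (0 : R), 0 < s -> A s).
  by apply: filterS hA => s h s0; apply: h; rewrite gt_eqF.
apply: (cvgr_to_le lim); near=> h => /=.
have h0 : 0 < h by [].
have hr : `|h| < r by rewrite gtr0_norm//; near: h; exact: nbhs_right_lt.
have hl : h < lam^-1 by near: h; apply: nbhs_right_lt; rewrite invr_gt0.
have eh : enorm (x + h *: e - x) = h.
  by rewrite addrAC subrr add0r enormZ e1 mulr1 gtr0_norm.
have hl' : lam * enorm (x + h *: e - x) <= 1.
  by rewrite eh mulrC -ler_pdivlMr ?div1r ?ltW.
have := two_point_estimate tS' (subset_closure (rD h hr)) (subset_closure Dx) hl'.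
rewrite eh (addrC x) => le.
change (h^-1 * (U t (h *: e + x) - U t x) <= K).
rewrite mulrC ler_pdivrMr//; apply: (le_trans le).
rewrite /psi ler_wpM2l ?(ltW K0)// lerBlDr lerDl divr_ge0// mulr_ge0 ?sqr_ge0// ltW.
Unshelve. all: by end_near. Qed.

End TwoPoint.
End MaximumPrinciple.

(** * Consequences of the regularity assumptions *)

Section Regularity.
Context {R : realType} {d : nat}.
Implicit Types (D : set 'rV[R]_d) (x y : 'rV[R]_d).

Lemma closure_bound D (f : 'rV[R]_d -> R) (c : R) : {within closure D, continuous f} ->
  (forall y, D y -> `|f y| <= c) -> forall x, closure D x -> `|f x| <= c.
Proof.
move=> /subspace_continuousP cf fc x cx; apply/ler_addgt0Pl => e e0.
have /cvgrPdist_le /(_ _ e0) h := cf x cx.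
have {}h : \forall y \near x, closure D y -> `|f x - f y| <= e := h.
have [y [Dy /(_ (subset_closure Dy)) fy]] := cx _ h.
have -> : f x = (f x - f y) + f y by rewrite subrK.
by apply: (le_trans (ler_normD _ _)); apply: lerD => //; exact: fc.
Qed.

(** Convergence in the sup norm over [D] extends to the closure, and the uniform
    limit of continuous functions is jointly continuous. The initial time is
    included, which the space-time regularity of the solution does not give. *)
Lemma C_C1_continuous (i : 'I_d) (S : R) D (U : R -> 'rV[R]_d -> R) : C_C1 S D U ->
  {within `[0, S] `*` closure D, continuous (fun z : R * 'rV[R]_d => U z.1 z.2)}.
Proof.
move=> UC; apply/subspace_continuousP => -[t x] [/= tI cx].
have tS : 0 <= t <= S by move: tI; rewrite in_itv.
have [Ut cvU] := UC t tS.
apply/cvgrPdist_le => e e0 /=.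
have e2 : 0 < e / 2 by rewrite divr_gt0.
have h1 : \forall s \near t, s \in `[0, S] -> forall y, closure D y -> `|U s y - U t y| <= e / 2.
  have lt0 : nbhs (0%E : \bar R) [set y | (y < (e / 2)%:E)%E].
    by apply: open_nbhs_nbhs; split; [exact: open_ereal_lt_ereal|rewrite /= lte_fin].
  have {}cvU : \forall s \near t, s \in `[0, S] -> (Ck_norm 1 D (U s \- U t)%R < (e / 2)%:E)%E.
    exact: cvU lt0.
  apply: filterS cvU => s h sI; have {}h := h sI.
  have sS : 0 <= s <= S by move: sI; rewrite in_itv.
  have [[cs _ _] _] := UC s sS; have [ct _ _] := Ut.
  apply: (@closure_bound D (fun y => U s y - U t y)); first exact: within_continuousB.
  move=> y Dy; rewrite -lee_fin; apply: le_trans (ltW h).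
  exact: (@Ck_norm_bound _ _ i 1 D (U s \- U t) [::] y isT Dy).
have h2 : \forall y \near x, closure D y -> `|U t x - U t y| <= e / 2.
  have [/subspace_continuousP /(_ x cx) /cvgrPdist_le /(_ _ e2) h _ _] := Ut.
  exact: h.
exists ([set s | s \in `[0, S] -> forall y, closure D y -> `|U s y - U t y| <= e / 2],
  [set y | closure D y -> `|U t x - U t y| <= e / 2]) => //=.
move=> [s y] [/= hs hy] [/= sI cy].
have -> : U t x - U s y = (U t x - U t y) - (U s y - U t y) by rewrite opprB addrA subrK.
apply: (le_trans (ler_normB _ _)); have := hs sI y cy; have := hy cy; lra.
Qed.

Lemma pair_const_continuous (t : R) : continuous (fun y : 'rV[R]_d => (t, y)).
Proof.
move=> y.
have h1 : (fun _ : 'rV[R]_d => t) @ nbhs y --> t by apply: cvg_cst.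
have h2 : id @ nbhs y --> y by exact: cvg_id.
exact: cvg_pair h1 h2.
Qed.

(** The continuous extension to the space-time closure restricts to each positive
    time. *)
Lemma C12_C2 (S : R) D (U : R -> 'rV[R]_d -> R) (t : R) : open D -> C12 S D U ->
  0 < t <= S -> C2_on D (U t).
Proof.
move=> oD [_ _ _ ex ct] tS.
have C1 s : (size s < 2)%N -> C1_on D (iter_partial s (U t)).
  move=> s2 i x Dx; split; first exact: ex t tS s i x s2 Dx.
  have [g [cg gE]] := ct (i :: s) s2.
  apply: (@within_closure_at _ _ D _ (fun y => g (t, y))) => //.
    apply: (@within_comp _ (R * 'rV[R]_d)%type R (closure D) _ (fun y => (t, y)) g _ _ cg).
      by apply: continuous_subspaceT; exact: pair_const_continuous.
    by move=> y cy; split => //=; rewrite in_itv.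
  by move=> y Dy; exact: gE.
by split; [exact: (C1 [::])|move=> j; exact: (C1 [:: j])].
Qed.

Lemma lebesgue_null0 : lebesgue_null (set0 : set (R * 'rV[R]_d)).
Proof.
move=> e e0; exists (fun=> 0), (fun=> 0), (fun=> 0), (fun=> 0); split => //.
by rewrite eseries0 ?lee_fin ?ltW// => k _ _; rewrite subrr mul0r.
Qed.

Lemma Linfty_norm_le (D : set (R * 'rV[R]_d)) (F : R * 'rV[R]_d -> 'rV[R]_d) (C : R) :
  0 <= C -> (forall z, D z -> enorm (F z) <= C) -> (Linfty_norm D F <= C%:E)%E.
Proof.
move=> C0 FC; apply: ereal_inf_lbound; split; first by rewrite lee_fin.
suff -> : [set z | D z /\ (C%:E < (enorm (F z))%:E)%E] = set0 by exact: lebesgue_null0.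
by apply/seteqP; split => // z [Dz]; rewrite lte_fin ltNge FC.
Qed.

End Regularity.

(** * The gradient bound *)

Theorem proposition6p2 (R : realType) (alpha : R) (d : nat)
  (Omega : set 'rV[R]_d) (S eps nu mu gmin gmax q eta : R) (H : R -> R)
  (alpha01 : 0 < alpha < 1)
  (d234 : d \in [:: 2; 3; 4]%N)
  (Omega_bounded : bounded_set Omega)
  (Omega_connected : connected Omega)
  (Omega_open : open Omega)
  (Omega_boundary : holder_boundary 4 alpha Omega)
  (S_gt0 : 0 < S)
  (eps_gt0 : 0 < eps)
  (nu_gt0 : 0 < nu)
  (mu_ge0 : 0 <= mu)
  (gmin_gt0 : 0 < gmin)
  (q01 : 0 < q < 1)
  (eta_bounds : 0 < eta < Num.min q (1 - q))
  (H_cutoff : smooth_cutoff H) :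
  exists C : R -> R -> R -> R,
    forall (G Lam U0 : 'rV[R]_d -> R) (U : R -> 'rV[R]_d -> R),
      holder_class 3 alpha Omega G ->
      (forall x, closure Omega x -> gmin <= G x <= gmax) ->
      holder_class 1 alpha Omega Lam ->
      (forall x, closure Omega x -> 0 <= Lam x) ->
      holder_class 2 alpha Omega U0 ->
      (forall x, boundary Omega x -> U0 x = 0) ->
      classical_solution S Omega eps nu mu q eta H G Lam U0 U ->
      Ck_norm 1 Omega (U t \- U0) @[t --> 0^'+] --> 0%E ->
      (forall t x, 0 <= t <= S -> closure Omega x -> 0 <= U t x <= 1) ->
      (Linfty_norm (`]0%R, S[ `*` Omega) (fun z => grad (U z.1) z.2) <=
        (C (fine (holder_norm 3 alpha Omega G))
           (fine (holder_norm 1 alpha Omega Lam))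
           (fine (holder_norm 2 alpha Omega U0)))%:E)%E.
Proof.
have d1 : (1 < d)%N by move: d234; rewrite !inE => /or3P[] /eqP ->.
have i : 'I_d := Ordinal (ltnW d1).
have [rho rho0 ext] := exterior_ball_uniform d1 Omega_open Omega_bounded Omega_boundary.
pose n : R := d%:R.
pose lamB (L : R) := (n * (nu + `|gmax|) / rho + n * L) / nu.
pose lamT (L Lm : R) := (n * (n * L) ^+ 2 / (4 * nu) + 2 * (n * L) + mu * Lm) / (4 * nu).
pose lam (L Lm : R) := 1 + lamB L + lamT L Lm.
exists (fun a b c => 2 * lam `|a| `|b| + 2 * (n * `|c|)).
move=> G Lam U0 U [GC Gfin] Gg [LC Lfin] L0 [UC Ufin] U0bd sol _ U01.
have [UC1 UC12 pde Uinit Ubd] := sol.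
set L : R := `|fine (holder_norm 3 alpha Omega G)|.
set Lm : R := `|fine (holder_norm 1 alpha Omega Lam)|.
set M0 : R := fine (holder_norm 2 alpha Omega U0).
have n0 : 0 <= n by rewrite ler0n.
have L_ge0 : 0 <= L by exact: normr_ge0.
have Lm_ge0 : 0 <= Lm by exact: normr_ge0.
have nL : 0 <= n * L by rewrite mulr_ge0.
have nu4 : 0 < 4 * nu by rewrite mulr_gt0.
have lamB0 : 0 <= lamB L.
  by rewrite divr_ge0 ?(ltW nu_gt0)// addr_ge0// divr_ge0 ?(ltW rho0)// mulr_ge0// addr_ge0// ltW.
have lamT0 : 0 <= lamT L Lm.
  rewrite divr_ge0 ?(ltW nu4)// addr_ge0 ?(mulr_ge0 mu_ge0)// addr_ge0 ?mulr_ge0//.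
  by rewrite invr_ge0 ltW.
have lam1 : 1 <= lam L Lm by rewrite /lam -addrA lerDl addr_ge0.
have nM : 0 <= n * `|M0| by rewrite mulr_ge0.
have Glip x j : Omega x -> `|partial j G x| <= L.
  move=> Ox; apply: le_trans (ler_norm _).
  exact: (holder_norm_bound j Omega_open Gfin (s := [:: j])).
have U0lip x j : Omega x -> `|partial j U0 x| <= `|M0|.
  move=> Ox; apply: le_trans (ler_norm _).
  exact: (holder_norm_bound j Omega_open Ufin (s := [:: j])).
have S0 := ltW S_gt0.
have Ubd' t x : 0 <= t <= S -> boundary Omega x -> U t x = 0.
  move=> /andP[t0 tS] bx; have [t00|tn0] := eqVneq t 0.
    by rewrite t00 Uinit ?U0bd//; case: bx.
  by apply: Ubd => //; rewrite tS andbT lt_neqAle eq_sym tn0.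
have Ulip x y : Omega x -> (forall t : R, 0 <= t < 1 -> Omega (x + t *: (y - x))) ->
    closure Omega y -> `|U 0 y - U 0 x| <= n * `|M0| * enorm (y - x).
  move=> Ox seg cy; rewrite !Uinit//; last exact: subset_closure.
  apply: (segment_lipschitz Omega_open (Ck_closure_C1 (s := [::]) Omega_open UC isT)).
  - by move=> z j; exact: U0lip.
  - by move=> t /andP[t0 t1]; apply: seg; rewrite ltW.
  - apply: within_closure_segment; first by case: UC.
    move=> t /andP[t0]; rewrite le_eqVlt => /orP[/eqP ->|t1].
      by rewrite scale1r addrC subrK.
    by apply: subset_closure; apply: seg; rewrite t0.
apply: Linfty_norm_le; first by rewrite addr_ge0 ?mulr_ge0// (le_trans ler01).
move=> [t x] [/= tI Ox].
have tS : 0 < t <= S by move: tI; rewrite in_itv /= => /andP[-> /ltW ->].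
apply: (@gradient_bound R d Omega S eps nu mu q eta H G Lam U `|gmax| L Lm (n * `|M0|)
  _ (lam L Lm) Omega_open Omega_bounded S0 eps_gt0 nu_gt0 mu_ge0 _ _ _ _ _ _ _ _ _ _ _ _
  lam1 _ _ _ _ rho rho0 ext _ t x tS Ox).
- by case: H_cutoff.
- exact: (Ck_closure_C1 (s := [::]) Omega_open GC isT).
- move=> y Oy; have /andP[g0 g1] := Gg y (subset_closure Oy).
  by rewrite (le_trans (ltW gmin_gt0) g0) (le_trans g1 (ler_norm _)).
- by move=> y j; exact: Glip.
- move=> y Oy; rewrite L0 /=; last exact: subset_closure.
  apply: le_trans (ler_norm _) _; apply: le_trans (ler_norm _).
  exact: (holder_norm_bound i Omega_open Lfin (s := [::])).
- by move=> s; exact: C12_C2.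
- exact: C_C1_continuous.
- by case: UC12 => _ h _ _ _ s y sS Oy; apply: h => //; exact: subset_closure.
- exact: pde.
- exact: U01.
- exact: Ubd'.
- exact: Ulip.
- by rewrite lerDl mulr_ge0.
- by rewrite lerDr mulr_ge0// (le_trans ler01).
- by [].
- by rewrite [ltRHS]mulrC -ltr_pdivrMr// -/n -/(lamT L Lm) /lam ltrDr ltr_pwDl.
- by rewrite [ltRHS]mulrC -ltr_pdivrMr// -/n -/(lamB L) /lam addrAC ltrDr ltr_pwDl.
Qed.
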